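(* Let $\phi$ be a window satisfying the assumption below and such that $$\inf_{\xi\in(-1/3,1/3)}|\hat\phi(\xi)|\ge\delta>0,\qquad \sup_{\xi\in(-1/3,1/3)}|\hat\phi(\xi)|\le M<\infty.$$ Then the family $\{F^\phi_{p,\tau}: p\in\mathbb Z,\ \tau=0,\dots,\beta(|p|)-1\}$ is a frame of $L^2([0,1])$; more precisely, for all $f\in L^2([0,1])$, $$\Big(\frac{\delta}{M}\Big)^2\|f\|^2_{L^2([0,1])}\le\sum_{p,\tau}\big|(f,F^\phi_{p,\tau})_{L^2([0,1])}\big|^2\le\Big(\frac{M}{\delta}\Big)^2\|f\|^2_{L^2([0,1])}.$$
   Context: Fourier transform on $\mathbb R$: $\hat\phi(\xi)=(2\pi)^{-1/2}\int e^{-2\pi it\xi}\phi(t)dt$. Assumption on $\phi$: $\hat\phi\in L^\infty(\mathbb R)$, $\hat\phi|_{(-1/3,1/3)}$ continuous, $\hat\phi(\xi)\ne0$ for $|\xi|<\frac13$, $\hat\phi(\xi)=0$ for a.e. $|\xi|>\frac13$, and $\lim_{\xi\to-1/3^+}\hat\phi(\xi)$ exists and is finite. Define $\nu,\beta$ by $\nu(0)=0,\beta(0)=1$; $\nu(1)=1,\beta(1)=1$; for $p\ge2$, $\nu(p)=2^{p-1}+2^{p-2}$, $\beta(p)=2^{p-1}$; $\nu(-p)=-\nu(p)$, $\beta(-p)=\beta(p)$. For $p\ge1$ and $j=0,\dots,\beta(p)-1$ let $c^\phi_{p,j}=\overline{\hat\phi\big(\frac{\beta(p)+j}{\nu(p)}-1\big)}$,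 where $\hat\phi(-\frac13)$ is understood as $\lim_{\xi\to-1/3^+}\hat\phi(\xi)$ (the arguments lie in $[-\frac13,\frac13)$). The window-adapted functions are, for $p\ge1$, $\tau=0,\dots,\beta(p)-1$, $$E^\phi_{p,\tau}(t)=\frac{1}{\sqrt{\beta(p)}}\sum_{j=0}^{\beta(p)-1}\big[c^\phi_{p,j}\big]^{-1}e^{2\pi i(\beta(p)+j)(t-\tau/\beta(p))},$$ with $E^\phi_{0,0}=1$ and $E^\phi_{p,\tau}=\overline{E^\phi_{-p,\tau}}$ for $p<0$; and $F^\phi_{p,\tau}=E^\phi_{p,\tau}/\|E^\phi_{p,\tau}\|_{L^2([0,1])}$. Inner product $(f,g)_{L^2([0,1])}=\int_0^1 f\bar g\,dt$. *)

(* Defs.v *)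
From HB Require Import structures.
From mathcomp Require Import all_boot all_order all_algebra.
From mathcomp Require Import all_classical all_reals all_analysis.
From mathcomp Require Import complex.

Set Implicit Arguments.
Unset Strict Implicit.
Unset Printing Implicit Defensive.

Import Order.TTheory GRing.Theory Num.Theory.
Import numFieldNormedType.Exports.
Local Open Scope classical_set_scope.
Local Open Scope ring_scope.

Section Defs.
Variable R : realType.
Local Notation C := (complex.complex R).
Local Notation mu := (@lebesgue_measure R).

Definition cabs (z : C) : R := ComplexField.Normc.normc z.

Definition expi (theta : R) : C := complex.Complex (cos theta) (sin theta).

Definition cR (x : R) : C := complex.Complex x 0.

Definition ip01 (f g : R -> C) : C :=
  complex.Complex
    (Rintegral mu `[0, 1] (fun t => complex.Re (f t * complex.conjc (g t))))
    (Rintegral mu `[0, 1] (fun t => complex.Im (f t * complex.conjc (g t)))).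

Definition norm2_01 (f : R -> C) : R :=
  Rintegral mu `[0, 1] (fun t => cabs (f t) ^+ 2).

Definition L2_01 (f : R -> C) : Prop :=
  [/\ measurable_fun (`[0, 1] : set R) (fun t => complex.Re (f t)),
      measurable_fun (`[0, 1] : set R) (fun t => complex.Im (f t)) &
      (\int[mu]_(t in (`[0%R, 1%R] : set R)) ((cabs (f t) ^+ 2)%:E) < +oo)%E].

(* nu(p), beta(p) for p >= 0 (only these values are used) *)
Definition nu (p : nat) : nat :=
  match p with 0 => 0 | 1 => 1 | _ => 2 ^ p.-1 + 2 ^ p.-2 end%N.
Definition beta (p : nat) : nat :=
  match p with 0 => 1 | 1 => 1 | _ => 2 ^ p.-1 end%N.

Definition phihat_ext (phihat : R -> C) (x : R) : C :=
  if x == - (1/3) then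
    complex.Complex (lim ((fun y => complex.Re (phihat y)) @ (- (1/3))^'+))
                    (lim ((fun y => complex.Im (phihat y)) @ (- (1/3))^'+))
  else phihat x.

Definition cphi (phihat : R -> C) (p j : nat) : C :=
  complex.conjc (phihat_ext phihat ((beta p + j)%:R / (nu p)%:R - 1)).

Definition Epos (phihat : R -> C) (p tau : nat) (t : R) : C :=
  cR (Num.sqrt (beta p)%:R)^-1 *
  \sum_(j < beta p)
     (cphi phihat p j)^-1 *
     expi (2 * pi * ((beta p + j)%:R * (t - tau%:R / (beta p)%:R))).

Definition Ephi (phihat : R -> C) (p : int) (tau : nat) : R -> C :=
  match p with
  | Posz 0 => fun _ => 1
  | Posz n => Epos phihat n tau
  | Negz n => fun t => complex.conjc (Epos phihat n.+1 tau t)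
  end.

Definition Fphi (phihat : R -> C) (p : int) (tau : nat) (t : R) : C :=
  Ephi phihat p tau t / cR (Num.sqrt (norm2_01 (Ephi phihat p tau))).

Definition frame_index : set (int * nat) :=
  [set pt | (pt.2 < beta `|pt.1|%N)%N].

Definition frame_sum (phihat : R -> C) (f : R -> C) : \bar R :=
  \esum_(pt in frame_index) ((cabs (ip01 f (Fphi phihat pt.1 pt.2)) ^+ 2)%:E).

End Defs.

(* Main.v *)
Require Import Defs.
From HB Require Import structures.
From mathcomp Require Import all_boot all_order all_algebra.
From mathcomp Require Import all_classical all_reals all_analysis.
From mathcomp Require Import measurable_realfun complex.
From mathcomp Require Import ring lra zify.

Import Order.TTheory GRing.Theory Num.Theory.
Import numFieldNormedType.Exports.
Local Open Scope classical_set_scope.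
Local Open Scope ring_scope.

(** The functions [E_{p,tau}], for fixed [p > 0], are combinations of the
    exponentials of the dyadic frequency block [beta p <= k < 2 beta p] with
    coefficients [c_{p,j}^-1], twisted by the characters of [Z / beta p].
    Parseval's identity for the discrete Fourier transform therefore gives
    [\sum_tau |(f, E_{p,tau})|^2 = \sum_j |c_{p,j}|^-2 |f^(beta p + j)|^2],
    while [||E_{p,tau}||^2] is the mean of the [|c_{p,j}|^-2]; since all of
    these lie in [[M^-2, delta^-2]], the energy of each normalised block is
    comparable, with constants [(delta / M)^2] and [(M / delta)^2], to the
    energy of [f] in the block. The blocks and their mirror images partition
    the nonzero integers, so the theorem reduces to Parseval's identity in
    [L^2([0,1])].

    Completeness of the trigonometric system is obtained without kernels. The
    bounded functions that are [L^2] limits of trigonometric polynomials form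
    an algebra closed under bounded pointwise convergence. Iterating the
    polynomial [x (3 - x^2) / 2] on [[-1, 1]] converges to the sign function,
    so the algebra contains the indicators of intervals (as superlevel sets of
    a shifted cosine), hence those of all Borel sets, hence all simple
    functions. *)

(** * Density of trigonometric polynomials *)

Section TrigDensity.
Set Implicit Arguments.
Unset Strict Implicit.
Variable R : realType.
Local Notation mu := (@lebesgue_measure R).
Local Notation I01 := (`[0%R, 1%R]%classic : set R).

Import HBNNSimple.

Lemma measurable_sqr_dist {D : set R} (u v : R -> R) :
  measurable_fun D u -> measurable_fun D v ->
  measurable_fun D (fun x => ((u x - v x) ^+ 2)%:E).
Proof.
by move=> mu_ mv; apply/measurable_EFinP/measurable_funX;
  exact: measurable_funB.
Qed.

Definition dist2 (u v : R -> R) : \bar R :=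
  (\int[mu]_(x in I01) ((u x - v x) ^+ 2)%:E)%E.

Lemma dist2_ge0 u v : (0 <= dist2 u v)%E.
Proof. by apply: integral_ge0 => x _; rewrite lee_fin sqr_ge0. Qed.

Lemma dist2_le (a b : R) (u v u1 v1 u2 v2 : R -> R) : 0 <= a -> 0 <= b ->
  measurable_fun I01 u -> measurable_fun I01 v ->
  measurable_fun I01 u1 -> measurable_fun I01 v1 ->
  measurable_fun I01 u2 -> measurable_fun I01 v2 ->
  (forall x, I01 x -> (u x - v x) ^+ 2 <=
     a * (u1 x - v1 x) ^+ 2 + b * (u2 x - v2 x) ^+ 2) ->
  (dist2 u v <= a%:E * dist2 u1 v1 + b%:E * dist2 u2 v2)%E.
Proof.
move=> a0 b0 m m' m1 m1' m2 m2' h.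
rewrite /dist2 -ge0_integralZl//; [|exact: measurable_sqr_dist|by move=> x _;
  rewrite lee_fin sqr_ge0].
rewrite -ge0_integralZl//; [|exact: measurable_sqr_dist|by move=> x _;
  rewrite lee_fin sqr_ge0].
rewrite -ge0_integralD//; first (apply: ge0_le_integral;
  first exact: measurable_itv).
- by move=> x _; rewrite lee_fin sqr_ge0.
- exact: measurable_sqr_dist.
- by apply: emeasurable_funD; apply: measurable_funeM;
    exact: measurable_sqr_dist.
- by move=> x Dx; rewrite -!EFinM -EFinD lee_fin; exact: h.
- by move=> x _; rewrite -EFinM lee_fin mulr_ge0 ?sqr_ge0.
- by apply: measurable_funeM; exact: measurable_sqr_dist.
- by move=> x _; rewrite -EFinM lee_fin mulr_ge0 ?sqr_ge0.
- by apply: measurable_funeM; exact: measurable_sqr_dist.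
Qed.

Definition trig_mono (a b : R) (k : int) (t : R) : R :=
  a * cos (2 * pi * (k%:~R * t)) + b * sin (2 * pi * (k%:~R * t)).

Inductive trig_poly : (R -> R) -> Prop :=
| trig_poly0 : trig_poly (fun=> 0)
| trig_polyS f a b k : trig_poly f ->
    trig_poly (fun t => f t + trig_mono a b k t).

Lemma continuous_trig_mono a b k : continuous (trig_mono a b k).
Proof.
move=> x; rewrite /trig_mono.
have h : {for x, continuous (fun t : R => 2 * pi * (k%:~R * t))}.
  by apply: cvgMr; apply: cvgMr; exact: cvg_id.
apply: cvgD; apply: cvgMr.
- exact: (continuous_comp h (@continuous_cos R _)).
- exact: (continuous_comp h (@continuous_sin R _)).
Qed.

Lemma measurable_trig_poly D f : trig_poly f -> measurable_fun D f.
Proof.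
elim => [|{}f a b k _ ih]; first exact: measurable_cst.
apply: measurable_funD => //; apply: measurable_funTS.
by apply: continuous_measurable_fun; exact: continuous_trig_mono.
Qed.

Lemma trig_polyD f g : trig_poly f -> trig_poly g ->
  trig_poly (fun t => f t + g t).
Proof.
move=> tf; elim => [|{}g a b k _ ih].
  by under eq_fun do rewrite addr0.
by under eq_fun do rewrite addrA; exact: trig_polyS.
Qed.

Lemma trig_poly_mono a b k : trig_poly (trig_mono a b k).
Proof.
rewrite (_ : trig_mono _ _ _ = fun t => 0 + trig_mono a b k t).
  by apply: trig_polyS; exact: trig_poly0.
by apply/funext => t; rewrite add0r.
Qed.

Lemma trig_mono_mul a b k c d l t :
  trig_mono a b k t * trig_mono c d l t =
  trig_mono ((a * c - b * d) / 2) ((a * d + b * c) / 2) (k + l) t +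
  trig_mono ((a * c + b * d) / 2) ((b * c - a * d) / 2) (k - l) t.
Proof.
rewrite /trig_mono.
have -> : 2 * pi * ((k + l)%:~R * t) = 2 * pi * (k%:~R * t) + 2 * pi * (l%:~R *
  t) :> R.
  by rewrite intrD; ring.
have -> : 2 * pi * ((k - l)%:~R * t) = 2 * pi * (k%:~R * t) - 2 * pi * (l%:~R *
  t) :> R.
  by rewrite intrB; ring.
by rewrite cosD cosB sinD sinB; field.
Qed.

Lemma trig_polyM f g : trig_poly f -> trig_poly g ->
  trig_poly (fun t => f t * g t).
Proof.
move=> tf; elim => [|{}g a b k _ ih].
  by under eq_fun do rewrite mulr0; exact: trig_poly0.
under eq_fun do rewrite mulrDr; apply: trig_polyD => // {ih}.
elim: tf => [|{}f c d l _ ih2].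
  by under eq_fun do rewrite mul0r; exact: trig_poly0.
under eq_fun do rewrite mulrDl; apply: trig_polyD => //.
under eq_fun do rewrite trig_mono_mul.
by apply: trig_polyD; exact: trig_poly_mono.
Qed.

Lemma trig_poly_cst a : trig_poly (fun=> a).
Proof.
rewrite (_ : (fun=> a) = trig_mono a 0 0); first exact: trig_poly_mono.
by apply/funext => t; rewrite /trig_mono !mul0r !mulr0 cos0 mulr1 addr0.
Qed.

Lemma exists_mul_le (K e : R) : 0 <= K -> 0 < e ->
  exists2 d : R, 0 < d & K * d <= e.
Proof.
move=> K0 e0; exists (e / (K + 1)); first by rewrite divr_gt0// ltr_wpDl.
by rewrite mulrCA ger_pMr// ler_pdivrMr ?mul1r ?lerDl// ltr_wpDl.
Qed.

Definition trig_approx (u : R -> R) : Prop :=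
  measurable_fun I01 u /\
  forall e : R, 0 < e -> exists2 T, trig_poly T & (dist2 u T <= e%:E)%E.

Lemma trig_approx_poly T : trig_poly T -> trig_approx T.
Proof.
move=> tT; split; first exact: measurable_trig_poly.
move=> e e0; exists T => //; rewrite /dist2.
under eq_integral do rewrite subrr expr0n/=.
by rewrite integral0 lee_fin ltW.
Qed.

Lemma trig_approx_closed u : measurable_fun I01 u ->
  (forall e : R, 0 < e -> exists2 v, trig_approx v & (dist2 u v <= e%:E)%E) ->
  trig_approx u.
Proof.
move=> mu_ h; split=> // e e0.
have e4 : 0 < e / 4 by rewrite divr_gt0.
have [v [mv hv] uv] := h _ e4.
have [T tT vT] := hv _ e4.
exists T => //.
have mT := @measurable_trig_poly I01 _ tT.
apply: (le_trans (@dist2_le 2 2 u T u v v T _ _ _ _ _ _ _ _ _)) => //.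
  move=> x _; rewrite -subr_ge0.
  have -> : 2 * (u x - v x) ^+ 2 + 2 * (v x - T x) ^+ 2 - (u x - T x) ^+ 2
     = ((u x - v x) - (v x - T x)) ^+ 2 by ring.
  exact: sqr_ge0.
apply: (@le_trans _ _ (2%:E * (e / 4)%:E + 2%:E * (e / 4)%:E)%E).
  by apply: leeD; apply: lee_pmul => //; rewrite ?lee_fin//; exact: dist2_ge0.
by rewrite -!EFinM -EFinD lee_fin; lra.
Qed.

Lemma trig_approx_lin a b u v : trig_approx u -> trig_approx v ->
  trig_approx (fun t => a * u t + b * v t).
Proof.
move=> [mu_ hu] [mv hv].
have mm : measurable_fun I01 (fun t => a * u t + b * v t).
  by apply: measurable_funD; apply: measurable_funM => //;
    exact: measurable_cst.
split=> // e e0.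
have ab0 : 0 <= 2 * a ^+ 2 + 2 * b ^+ 2.
  by rewrite addr_ge0// mulr_ge0// sqr_ge0.
have [d d0 hd] := exists_mul_le ab0 e0.
have [S tS uS] := hu _ d0; have [T tT vT] := hv _ d0.
exists (fun t => a * S t + b * T t).
  by apply: trig_polyD; apply: trig_polyM => //; exact: trig_poly_cst.
have mT := @measurable_trig_poly I01 _ tT.
have mS := @measurable_trig_poly I01 _ tS.
apply: (le_trans (@dist2_le (2 * a ^+ 2) (2 * b ^+ 2) _ _ u S v T _ _ _ _ _ _ _
  _ _)) => //.
- by rewrite mulr_ge0// sqr_ge0.
- by rewrite mulr_ge0// sqr_ge0.
- by apply: measurable_funD; apply: measurable_funM => //;
    exact: measurable_cst.
- move=> x _; rewrite -subr_ge0.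
  have -> : 2 * a ^+ 2 * (u x - S x) ^+ 2 + 2 * b ^+ 2 * (v x - T x) ^+ 2
     - (a * u x + b * v x - (a * S x + b * T x)) ^+ 2
     = (a * (u x - S x) - b * (v x - T x)) ^+ 2 by ring.
  exact: sqr_ge0.
apply: (@le_trans _ _ ((2 * a ^+ 2)%:E * d%:E + (2 * b ^+ 2)%:E * d%:E)%E).
  by apply: leeD; apply: lee_pmul => //; first [exact: dist2_ge0 | by rewrite
    lee_fin mulr_ge0// sqr_ge0].
by rewrite -!EFinM -EFinD lee_fin -mulrDl.
Qed.

Lemma dist2_mul_bounded (K : R) (u v g : R -> R) :
  measurable_fun I01 u -> measurable_fun I01 v -> measurable_fun I01 g ->
  (forall x, I01 x -> `|g x| <= K) ->
  (dist2 (fun t => u t * g t)%R (fun t => v t * g t)%R <=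
   (K ^+ 2)%:E * dist2 u v)%E.
Proof.
move=> m1 m2 m3 gK.
have := @dist2_le (K ^+ 2) 0 (fun t => u t * g t) (fun t => v t * g t) u v u v.
rewrite mul0e adde0; apply => //; rewrite ?sqr_ge0//;
  try by apply: measurable_funM.
move=> x Ix; rewrite mul0r addr0 -mulrBl exprMn mulrC.
apply: ler_wpM2r; first exact: sqr_ge0.
by rewrite -(real_normK (num_real (g x))) lerXn2r ?nnegrE ?normr_ge0 ?gK//
  (le_trans _ (gK x Ix)).
Qed.

Lemma trig_mono_bounded a b k t : `|trig_mono a b k t| <= `|a| + `|b|.
Proof.
rewrite (le_trans (ler_normD _ _))// !normrM lerD//.
  by rewrite ler_piMr// cos_max.
by rewrite ler_piMr// sin_max.
Qed.

Lemma trig_approx_mul_mono a b k u : trig_approx u ->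
  trig_approx (fun t => u t * trig_mono a b k t).
Proof.
move=> [mu_ hu].
have mm := @measurable_trig_poly I01 _ (trig_poly_mono a b k).
split; first exact: measurable_funM.
move=> e e0; have [d d0 hd] := exists_mul_le (sqr_ge0 (`|a| + `|b|)) e0.
have [T tT uT] := hu _ d0.
exists (fun t => T t * trig_mono a b k t).
  by apply: trig_polyM => //; exact: trig_poly_mono.
apply: (le_trans (dist2_mul_bounded (K := `|a| + `|b|) mu_
  (measurable_trig_poly tT) mm _)).
  by move=> x _; exact: trig_mono_bounded.
apply: (@le_trans _ _ (((`|a| + `|b|) ^+ 2)%:E * d%:E)%E);
  last by rewrite -EFinM lee_fin.
by apply: lee_pmul => //; exact: dist2_ge0.
Qed.

Lemma trig_approx_mul_poly T (g : R -> R) : trig_poly T -> trig_approx g ->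
  trig_approx (fun t => T t * g t).
Proof.
move=> tT ag; elim: tT => [|f a b k _ ih].
  under eq_fun do rewrite mul0r.
  by apply: trig_approx_poly; exact: trig_poly0.
rewrite [X in trig_approx X](_ : _ = fun t =>
  1 * (f t * g t) + 1 * (g t * trig_mono a b k t)).
  by apply: trig_approx_lin => //; exact: trig_approx_mul_mono.
by apply/funext => t; rewrite !mul1r mulrDl (mulrC (trig_mono _ _ _ _)).
Qed.

Lemma trig_approxM (K : R) (f g : R -> R) : trig_approx f -> trig_approx g ->
  (forall x, I01 x -> `|g x| <= K) -> trig_approx (fun t => f t * g t).
Proof.
move=> [mf af] ag gK; have mg := ag.1.
apply: trig_approx_closed; first exact: measurable_funM.
move=> e e0; have [d d0 hd] := exists_mul_le (sqr_ge0 K) e0.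
have [T tT uT] := af _ d0.
exists (fun t => T t * g t); first exact: trig_approx_mul_poly.
apply: (le_trans (dist2_mul_bounded mf (measurable_trig_poly tT) mg gK)).
apply: (@le_trans _ _ ((K ^+ 2)%:E * d%:E)%E); last by rewrite -EFinM lee_fin.
apply: lee_pmul => //; first [exact: dist2_ge0|by rewrite lee_fin sqr_ge0].
Qed.

Lemma trig_approx_dominated (G : R -> R) (u_ : nat -> R -> R) (u : R -> R) :
  measurable_fun I01 u ->
  (forall n, trig_approx (u_ n)) -> mu.-integrable I01 (EFin \o G) ->
  (forall n x, I01 x -> (u x - u_ n x) ^+ 2 <= G x) ->
  (forall x, I01 x -> u_ n x @[n --> \oo] --> u x) ->
  trig_approx u.
Proof.
move=> mu_ au iG uG uu; apply: trig_approx_closed => // e e0.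
have h : (dist2 u (u_ n) @[n --> \oo] --> 0)%E.
  have -> : (0 = \int[mu]_(x in I01) (cst 0 x) :> \bar R)%E by rewrite
    integral0.
  apply: (@dominated_cvg _ _ _ mu I01 (measurable_itv _)
    (fun n x => ((u x - u_ n x) ^+ 2)%:E) (cst 0%E) (EFin \o G)) => //.
  - by move=> n; apply: measurable_sqr_dist => //; exact: (au n).1.
  - move=> x Ix; apply: cvg_EFin; first exact: nearW.
    rewrite [X in X @ _ --> _](_ : _ = fun n => (u x - u_ n x) * (u x - u_ n
      x)).
      rewrite -[X in _ --> X](mulr0 (0 : R)).
      by apply: cvgM; rewrite -(subrr (u x)); apply: cvgB => //;
        [exact: cvg_cst|exact: uu|exact: cvg_cst|exact: uu].
    by apply/funext => n /=; rewrite expr2.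
  - by move=> n x Ix; rewrite lee_fin/= ger0_norm ?sqr_ge0 ?uG.
have : \forall n \near \oo, (dist2 u (u_ n) < e%:E)%E.
  exact: (h _ (@nbhs_open_ereal_lt R 0 (fun=> e) e0)).
by case=> N _ /(_ N (leqnn N)) /ltW; exists (u_ N).
Qed.

Lemma integrable_I01_cst (K : R) : mu.-integrable I01 (EFin \o (fun=> K)).
Proof.
apply/integrableP; split; first exact: measurable_cst.
rewrite integral_cst//= lebesgue_measure_itv/= lte_fin ltr01 sube0 mule1.
exact: ltry.
Qed.

Lemma trig_approx_bounded_cvg (K : R) (u_ : nat -> R -> R) (u : R -> R) :
  (forall n, trig_approx (u_ n)) ->
  (forall n x, I01 x -> `|u_ n x| <= K) ->
  (forall x, I01 x -> u_ n x @[n --> \oo] --> u x) ->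
  trig_approx u.
Proof.
move=> au uK uu.
have mu_ : measurable_fun I01 u.
  by apply: measurable_fun_cvg uu => n; exact: (au n).1.
apply: (@trig_approx_dominated (fun=> (K + K) ^+ 2) u_) => //.
  exact: integrable_I01_cst.
have uK' x : I01 x -> `|u x| <= K.
  move=> Ix; have hn := cvg_norm (uu x Ix).
  have := @ler_cvg_to nat \oo _ R (fun n => `|u_ n x|) (fun=> K) `|u x| K (hn
    _) (cvg_cst K).
  apply.
  by apply: nearW => n; exact: uK.
move=> n x Ix; rewrite -real_normK ?num_real// lerXn2r ?nnegrE//.
  by rewrite addr_ge0// (le_trans _ (uK' x Ix)).
by rewrite (le_trans (ler_normB _ _))// lerD ?uK ?uK'.
Qed.

Definition smoothstep (x : R) : R := x * (3 - x ^+ 2) / 2.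

Lemma smoothstep_bounded x : `|x| <= 1 -> `|smoothstep x| <= 1.
Proof.
rewrite !ler_norml /smoothstep => /andP[h1 h2]; apply/andP; split.
- rewrite -subr_ge0.
  rewrite (_ : _ - _ = (1 + x) ^+ 2 * (2 - x) / 2); last by field.
  by rewrite divr_ge0// mulr_ge0 ?sqr_ge0//; lra.
- rewrite -subr_ge0.
  rewrite (_ : _ - _ = (1 - x) ^+ 2 * (2 + x) / 2); last by field.
  by rewrite divr_ge0// mulr_ge0 ?sqr_ge0//; lra.
Qed.

Lemma iter_smoothstep_bounded n x : `|x| <= 1 -> `|iter n smoothstep x| <= 1.
Proof. by move=> x1; elim: n => // n ih; exact: smoothstep_bounded. Qed.

Lemma iter_smoothstepN n x : iter n smoothstep (- x) = - iter n smoothstep x.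
Proof.
elim: n => //= n ->; rewrite /smoothstep sqrrN; ring.
Qed.

Lemma iter_smoothstep_pos n x : 0 < x <= 1 ->
  x <= iter n smoothstep x <= 1 /\ 1 - iter n smoothstep x <= (1 - x / 2) ^+ n.
Proof.
move=> /andP[x0 x1]; elim: n => [|n [/andP[h1 h2] h3]] /=.
  by rewrite lexx x1 expr0; split => //; lra.
set y := iter n smoothstep x in h1 h2 h3 *.
have y0 : 0 < y by rewrite (lt_le_trans x0).
have E1 : smoothstep y - y = y * (1 - y) * (1 + y) / 2 by rewrite /smoothstep;
  field.
have E2 : 1 - smoothstep y = (1 - y) ^+ 2 * (2 + y) / 2 by rewrite /smoothstep;
  field.
have E3 : smoothstep y = 1 - (1 - y) * (1 - y / 2) + y ^+ 2 * (1 - y) / 2.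
  by rewrite /smoothstep; field.
have p1 : 0 <= y * (1 - y) * (1 + y) / 2.
  by rewrite divr_ge0// !mulr_ge0//; lra.
have p2 : 0 <= (1 - y) ^+ 2 * (2 + y) / 2.
  by rewrite divr_ge0// mulr_ge0 ?sqr_ge0//; lra.
have p3 : 0 <= y ^+ 2 * (1 - y) / 2.
  by rewrite divr_ge0// mulr_ge0 ?sqr_ge0//; lra.
split; first by apply/andP; split; lra.
rewrite exprS (@le_trans _ _ ((1 - y) * (1 - x / 2)))//.
  have : (1 - y) * (1 - y / 2) <= (1 - y) * (1 - x / 2) by apply: ler_wpM2l;
    lra.
  by lra.
by rewrite mulrC; apply: ler_wpM2l => //; lra.
Qed.

Lemma cvg_iter_smoothstep x : `|x| <= 1 ->
  iter n smoothstep x @[n --> \oo] --> Num.sg x.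
Proof.
have pos z : 0 < z <= 1 -> iter n smoothstep z @[n --> \oo] --> (1 : R).
  move=> z01; have /andP[z0 z1] := z01.
  rewrite -[X in _ --> X]subr0.
  rewrite (_ : (fun n => _) = fun n => 1 - (1 - iter n smoothstep z));
    last first.
    by apply/funext => n; rewrite subKr.
  apply: cvgB; first exact: cvg_cst.
  apply: (@squeeze_cvgr _ _ _ _ (fun=> 0) (fun n => (1 - z / 2) ^+ n)).
  - apply: nearW => n; have [/andP[_ h1] h2] := iter_smoothstep_pos n z01.
    by rewrite subr_ge0 h1 h2.
  - exact: cvg_cst.
  - by apply: cvg_expr; rewrite ger0_norm; lra.
move=> x1; have [x0|x0|->] := ltrgtP x 0.
- rewrite ltr0_sg//.
  rewrite (_ : (fun n => _) = fun n => - iter n smoothstep (- x)); last first.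
    by apply/funext => n; rewrite iter_smoothstepN opprK.
  by apply: cvgN; apply: pos; rewrite oppr_gt0 x0 -(ltr0_norm x0).
- by rewrite gtr0_sg//; apply: pos; rewrite x0 -(gtr0_norm x0).
- rewrite sgr0 (_ : (fun n => _) = fun=> 0); first exact: cvg_cst.
  by apply/funext; elim => //= n ->; rewrite /smoothstep !mul0r.
Qed.

Lemma trig_approx_smoothstep f : trig_approx f ->
  (forall x, I01 x -> `|f x| <= 1) -> trig_approx (fun t => smoothstep (f t)).
Proof.
move=> af f1.
have af2 := trig_approxM af af f1.
have f21 x : I01 x -> `|f x * f x| <= 1.
  by move=> Ix; rewrite normrM mulr_ile1 ?f1.
have af3 := trig_approxM af af2 f21.
rewrite (_ : (fun t => _) = fun t => (3 / 2) * f t + (- (1 / 2)) * (f t * (f t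
  * f t))).
  exact: trig_approx_lin.
by apply/funext => t; rewrite /smoothstep; field.
Qed.

Lemma trig_approx_sg f : trig_approx f -> (forall x, I01 x -> `|f x| <= 1) ->
  trig_approx (fun t => Num.sg (f t)).
Proof.
move=> af f1.
apply: (@trig_approx_bounded_cvg 1 (fun n t => iter n smoothstep (f t))).
- elim => //= n ih; apply: trig_approx_smoothstep => //.
  by move=> x Ix; exact/iter_smoothstep_bounded/f1.
- by move=> n x Ix; exact/iter_smoothstep_bounded/f1.
- by move=> x Ix; exact/cvg_iter_smoothstep/f1.
Qed.

Lemma trig_approx_eq_oo (u v : R -> R) : trig_approx u -> measurable_fun I01 v
  ->
  (forall x, 0 < x < 1 -> u x = v x) -> trig_approx v.
Proof.
move=> [mu_ au] mv uv; split=> // e e0; have [T tT uT] := au _ e0;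
  exists T => //.
rewrite (_ : dist2 v T = dist2 u T)//.
have mT := @measurable_trig_poly I01 _ tT.
have E w : measurable_fun I01 w ->
    dist2 w T = (\int[mu]_(x in `]0%R, 1%R[) ((w x - T x) ^+ 2)%:E)%E.
  move=> mw; have mwT := measurable_sqr_dist mw mT.
  rewrite /dist2 -integral_itv_bndo_bndc; last first.
    apply: measurable_funS mwT => // z /=.
    by rewrite !in_itv/= => /andP[-> /ltW ->].
  rewrite -integral_itv_obnd_cbnd//.
  apply: measurable_funS mwT => // z /=.
  by rewrite !in_itv/= => /andP[/ltW -> /ltW ->].
rewrite !E//; apply: eq_integral => x; rewrite inE/= in_itv/= => x01.
by rewrite uv.
Qed.

Lemma trig_approx_cst (a : R) : trig_approx (fun=> a).
Proof. by apply: trig_approx_poly; exact: trig_poly_cst. Qed.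

(* [cos (2 pi t - pi a) - cos (pi a) = 2 sin (pi t) sin (pi (a - t))] has the
   sign of [a - t] on [0 < t < 1]. *)
Lemma trig_approx_itv (a : R) : 0 < a <= 1 ->
  trig_approx (\1_(`]-oo, a[%classic) : R -> R).
Proof.
move=> /andP[a0 a1].
pose f t := (trig_mono (cos (pi * a)) (sin (pi * a)) 1 t - cos (pi * a)) / 2 :
  R.
have af : trig_approx f.
  rewrite (_ : f = fun t => (1 / 2) * trig_mono (cos (pi * a)) (sin (pi * a)) 1
    t
      + (1 / 2) * (- cos (pi * a))).
    apply: trig_approx_lin; last exact: trig_approx_cst.
    by apply: trig_approx_poly; exact: trig_poly_mono.
  by apply/funext => t; rewrite /f; field.
have fE t : f t = sin (pi * t) * sin (pi * (a - t)).
  rewrite /f /trig_mono mul1r.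
  have -> : 2 * pi * t = pi * t + pi * t by ring.
  rewrite mulrBr sinB cosD sinD.
  have := cos2Dsin2 (pi * t).
  set c := cos (pi * t); set s := sin (pi * t); set ca := cos _;
    set sa := sin _ => h.
  have -> : c * c = 1 - s * s by rewrite -!expr2 -h addrK.
  by field.
have f1 x : I01 x -> `|f x| <= 1.
  by move=> _; rewrite fE normrM mulr_ile1 ?sin_max.
have ag := trig_approx_sg af f1.
have g1 x : I01 x -> `|Num.sg (f x)| <= 1.
  by move=> _; rewrite normr_sg; case: (_ != _); rewrite ?ler01 ?lexx.
have ag2 := trig_approxM ag ag g1.
have := trig_approx_lin (1 / 2) (1 / 2) ag ag2.
move/trig_approx_eq_oo; apply; first by apply: measurable_indic.
move=> x /andP[x0 x1].
have s0 : 0 < sin (pi * x).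
  by apply: sin_gt0_pi; rewrite mulr_gt0 ?pi_gt0//= gtr_pMr ?pi_gt0.
rewrite fE sgrM gtr0_sg// mul1r indicE.
have [xa|xa|xa] := ltrgtP x a.
- rewrite mem_set/=; last by rewrite in_itv.
  rewrite gtr0_sg; first by field.
  apply: sin_gt0_pi; rewrite mulr_gt0 ?pi_gt0 ?subr_gt0//= gtr_pMr ?pi_gt0//.
  lra.
- rewrite memNset/=; last by rewrite in_itv/= ltNge (ltW xa).
  rewrite ltr0_sg; first by field.
  rewrite -oppr_gt0 -sinN -mulrN opprB.
  apply: sin_gt0_pi; rewrite mulr_gt0 ?pi_gt0 ?subr_gt0//= gtr_pMr ?pi_gt0//.
  lra.
- rewrite xa subrr mulr0 sin0 sgr0 memNset//=; last by rewrite in_itv/= ltxx.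
  by field.
Qed.

Lemma indic_bounded (A : set R) (x : R) : `|\1_A x| <= 1 :> R.
Proof. by rewrite indicE; case: (_ \in _); rewrite ?normr1 ?normr0. Qed.

Lemma trig_approx_indic_ray (a : R) :
  trig_approx (\1_(`]-oo, a[%classic) : R -> R).
Proof.
have [a0|a0] := leP a 0.
  apply: (@trig_approx_eq_oo (fun=> 0)); first exact: trig_approx_cst.
    exact: measurable_indic.
  move=> x /andP[x0 _]; rewrite indicE memNset//= in_itv/=; lra.
have [a1|a1] := leP a 1; first by apply: trig_approx_itv; rewrite a0.
apply: (@trig_approx_eq_oo (fun=> 1)); first exact: trig_approx_cst.
  exact: measurable_indic.
by move=> x /andP[x0 x1]; rewrite indicE mem_set//= in_itv/=; lra.
Qed.

Lemma trig_approx_indicU (A B : set R) :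
  trig_approx (\1_A : R -> R) -> trig_approx (\1_B : R -> R) ->
  trig_approx (\1_(A `|` B) : R -> R).
Proof.
move=> aA aB.
have aAB := trig_approxM aA aB (fun x _ => indic_bounded B x).
have := trig_approx_lin 1 (- 1) (trig_approx_lin 1 1 aA aB) aAB.
congr trig_approx; apply/funext => x; rewrite !indicE in_setU.
by case: (x \in A); case: (x \in B) => /=; ring.
Qed.

Lemma trig_approx_indic (A : set R) : measurable A ->
  trig_approx (\1_A : R -> R).
Proof.
move=> mA; have : (@ocitv R).-sigma.-measurable A by [].
rewrite RGenInftyO.measurableE; move: A {mA}; apply: smallest_sub.
  split.
  - by rewrite indic0; exact: trig_approx_cst.
  - move=> {}A aA.
    have := trig_approx_lin 1 (- 1) (trig_approx_cst 1) aA.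
    congr trig_approx; apply/funext => x; rewrite !indicE setTD in_setC.
    by case: (x \in A) => /=; ring.
  - move=> F aF.
    pose u n : R -> R := \1_(\big[setU/set0]_(i < n) F i).
    apply: (@trig_approx_bounded_cvg 1 u).
    + move=> n; rewrite /u; elim: n => [|n ih].
        by rewrite big_ord0 indic0; exact: trig_approx_cst.
      by rewrite big_ord_recr/=; exact: trig_approx_indicU.
    + by move=> n x _; exact: indic_bounded.
    + move=> x _; apply: cvg_near_cst.
      rewrite indicE; case: (boolP (x \in _)) => [/set_mem[k _ Fkx]|nx].
        exists k.+1 => // n /= kn; rewrite /u indicE mem_set//.
        by rewrite -bigcup_mkord; exists k.
      apply: nearW => n; rewrite /u indicE memNset//.
      rewrite -bigcup_mkord => -[k _ Fkx]; move/negP: nx; apply.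
      by apply/mem_set; exists k.
by move=> _ [x ->]; exact: trig_approx_indic_ray.
Qed.

Lemma trig_approx_sum (I : Type) (s : seq I) (F : I -> R -> R) :
  (forall i, trig_approx (F i)) -> trig_approx (fun x => \sum_(i <- s) F i x).
Proof.
move=> aF; elim: s => [|i s ih].
  by under eq_fun do rewrite big_nil; exact: trig_approx_cst.
have := trig_approx_lin 1 1 (aF i) ih.
by congr trig_approx; apply/funext => x; rewrite big_cons !mul1r.
Qed.

Lemma trig_approx_nnsfun (g : {nnsfun R >-> R}) : trig_approx (g : R -> R).
Proof.
rewrite (_ : (g : R -> R) = fun x =>
  \sum_(y \in range g) y * \1_(g @^-1` [set y]) x); last first.
  by apply/funext => x; rewrite fimfunE.
under eq_fun do rewrite fsbig_finite//=.
apply: trig_approx_sum => y.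
have aI : trig_approx (\1_(g @^-1` [set y]) : R -> R).
  by apply: trig_approx_indic.
have := trig_approx_lin y 0 aI aI.
by congr trig_approx; apply/funext => x; rewrite mul0r addr0.
Qed.

Lemma trig_approx_ge0 (u : R -> R) : measurable_fun I01 u ->
  (forall x, I01 x -> 0 <= u x) ->
  mu.-integrable I01 (EFin \o (fun x => u x ^+ 2)) -> trig_approx u.
Proof.
move=> mu_ u0 iu.
have mI : measurable I01 by exact: measurable_itv.
have mEu : measurable_fun I01 (EFin \o u) by exact/measurable_EFinP.
have u0' x : I01 x -> (0 <= (EFin \o u) x)%E by move=> Ix; rewrite lee_fin u0.
pose g := nnsfun_approx mI mEu.
have gu x : I01 x -> g n x @[n --> \oo] --> u x.
  move=> Ix; have := cvg_nnsfun_approx mI mEu u0' Ix.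
  by move/fine_cvg.
have gle n x : I01 x -> g n x <= u x.
  move=> Ix; apply: (@ler_cvg_to nat \oo _ R (fun=> g n x) (fun m => g m x)).
  - exact: cvg_cst.
  - exact: gu.
  - exists n => // m /= nm; have /lefP := nd_nnsfun_approx mI mEu nm.
    exact.
apply: (@trig_approx_dominated (fun x => u x ^+ 2) g) => //.
- by move=> n; exact: trig_approx_nnsfun.
- move=> n x Ix; rewrite lerXn2r ?nnegrE ?subr_ge0 ?gle ?u0//.
  by rewrite gerBl.
Qed.

Theorem trig_approx_L2 (u : R -> R) : measurable_fun I01 u ->
  mu.-integrable I01 (EFin \o (fun x => u x ^+ 2)) -> trig_approx u.
Proof.
move=> mu_ iu.
have mI : measurable I01 by exact: measurable_itv.
have h (v : R -> R) : measurable_fun I01 v -> (forall x, I01 x -> 0 <= v x <=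
  `|u x|) ->
    trig_approx v.
  move=> mv vu; apply: trig_approx_ge0 => //; first by move=> x /vu/andP[].
  apply: le_integrable iu => //.
    by apply/measurable_EFinP; exact: measurable_funX.
  move=> x Ix /=; rewrite lee_fin !ger0_norm ?sqr_ge0//.
  have /andP[v0 v1] := vu x Ix.
  by rewrite -[leRHS]real_normK ?num_real// lerXn2r ?nnegrE.
have mN : measurable_fun I01 (fun x => `|u x|) by exact: measurableT_comp.
have h1 : trig_approx (fun x => (`|u x| + u x) / 2).
  apply: h.
    by apply: measurable_funM => //; exact: measurable_funD.
  by move=> x _; case: (lerP 0 (u x)) => u0;
    [rewrite ger0_norm//|rewrite ltr0_norm//]; apply/andP; lra.
have h2 : trig_approx (fun x => (`|u x| - u x) / 2).
  apply: h.
    by apply: measurable_funM => //; exact: measurable_funB.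
  by move=> x _; case: (lerP 0 (u x)) => u0;
    [rewrite ger0_norm//|rewrite ltr0_norm//]; apply/andP; lra.
have := trig_approx_lin 1 (- 1) h1 h2.
by congr trig_approx; apply/funext => x; field.
Qed.

End TrigDensity.

(** * Fourier coefficients of complex square-integrable functions *)

Section FourierCoefficients.
Set Implicit Arguments.
Unset Strict Implicit.
Variable R : realType.
Local Notation mu := (@lebesgue_measure R).
Local Notation I01 := (`[0%R, 1%R]%classic : set R).
Local Notation C := (complex.complex R).
Local Notation Re := complex.Re.
Local Notation Im := complex.Im.
Local Notation conjc := complex.conjc.

Lemma Re_mul (x y : C) : Re (x * y) = Re x * Re y - Im x * Im y.
Proof. by case: x y => a b [c d]. Qed.

Lemma Im_mul (x y : C) : Im (x * y) = Re x * Im y + Im x * Re y.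
Proof. by case: x y => a b [c d]. Qed.

Lemma Re_add (x y : C) : Re (x + y) = Re x + Re y.
Proof. by case: x y => a b [c d]. Qed.

Lemma Im_add (x y : C) : Im (x + y) = Im x + Im y.
Proof. by case: x y => a b [c d]. Qed.

Lemma Re_conj (x : C) : Re (conjc x) = Re x.
Proof. by case: x. Qed.

Lemma Im_conj (x : C) : Im (conjc x) = - Im x.
Proof. by case: x. Qed.

Lemma eq_ReIm (x y : C) : Re x = Re y -> Im x = Im y -> x = y.
Proof. by case: x y => a b [c d] /= -> ->. Qed.

Definition ReImE := (Re_mul, Im_mul, Re_add, Im_add, Re_conj, Im_conj).

Lemma conjcM (x y : C) : conjc (x * y) = conjc x * conjc y.
Proof. by apply: eq_ReIm; rewrite !ReImE; ring. Qed.

Lemma conjcD (x y : C) : conjc (x + y) = conjc x + conjc y.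
Proof. by apply: eq_ReIm; rewrite !ReImE; ring. Qed.

Lemma conjc_sum (I : Type) (s : seq I) (F : I -> C) :
  conjc (\sum_(i <- s) F i) = \sum_(i <- s) conjc (F i).
Proof.
elim: s => [|i s ih]; first by rewrite !big_nil; apply: eq_ReIm;
  rewrite !ReImE//= oppr0.
by rewrite !big_cons conjcD ih.
Qed.

Lemma sqr_cabs (z : C) : cabs z ^+ 2 = Re z ^+ 2 + Im z ^+ 2.
Proof. by case: z => a b; rewrite /cabs/= sqr_sqrtr// addr_ge0// sqr_ge0. Qed.

Lemma cR_sqr_cabs (z : C) : cR (cabs z ^+ 2) = z * conjc z.
Proof. by apply: eq_ReIm; rewrite !ReImE /= ?sqr_cabs; ring. Qed.

Lemma cRD (x y : R) : cR (x + y) = cR x + cR y.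
Proof. by apply: eq_ReIm; rewrite !ReImE /= ?addr0. Qed.

Lemma cRM (x y : R) : cR (x * y) = cR x * cR y.
Proof. by apply: eq_ReIm; rewrite !ReImE /=; ring. Qed.

Lemma cRN (x : R) : cR (- x) = - cR x.
Proof. by apply: eq_ReIm => //=; rewrite oppr0. Qed.

Lemma cR_sum (I : Type) (s : seq I) (F : I -> R) :
  cR (\sum_(i <- s) F i) = \sum_(i <- s) cR (F i).
Proof. by elim: s => [|i s ih]; rewrite ?big_nil// !big_cons cRD ih. Qed.

Lemma cR_inj : injective (@cR R).
Proof. by move=> x y []. Qed.

Lemma conj_cR (x : R) : conjc (cR x) = cR x.
Proof. by apply: eq_ReIm; rewrite !ReImE//= oppr0. Qed.

Lemma cabsM (x y : C) : cabs (x * y) = cabs x * cabs y.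
Proof. exact: ComplexField.Normc.normcM. Qed.

Lemma cabs_ge0 (x : C) : 0 <= cabs x.
Proof. by case: x => a b; exact: sqrtr_ge0. Qed.

Lemma cabs_conj (x : C) : cabs (conjc x) = cabs x.
Proof.
apply/eqP; rewrite -(@eqrXn2 _ 2%N) ?cabs_ge0// !sqr_cabs !ReImE sqrrN//.
Qed.

Lemma expiD (a b : R) : expi (a + b) = expi a * expi b.
Proof. by apply: eq_ReIm; rewrite !ReImE /= ?cosD ?sinD//; ring. Qed.

Lemma conj_expi (a : R) : conjc (expi a) = expi (- a).
Proof. by apply: eq_ReIm; rewrite !ReImE /= ?cosN ?sinN. Qed.

Lemma expi0 : expi (0 : R) = 1.
Proof. by apply: eq_ReIm; rewrite /= ?cos0 ?sin0. Qed.

Lemma expi_2pi_nat (n : nat) : expi (2 * pi * n%:R) = 1 :> C.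
Proof.
elim: n => [|n ih]; first by rewrite mulr0 expi0.
rewrite -[n.+1]addn1 natrD mulrDr expiD ih mul1r mulr1 mulr_natl.
by apply: eq_ReIm; rewrite /= ?cos2pi ?sin2pi.
Qed.

Lemma expi_2pi_int (k : int) : expi (2 * pi * k%:~R) = 1 :> C.
Proof.
case: k => n; first exact: expi_2pi_nat.
rewrite NegzE intrN mulrN -conj_expi expi_2pi_nat.
by apply: eq_ReIm; rewrite !ReImE//= oppr0.
Qed.

Lemma cabs_expi (a : R) : cabs (expi a) = 1.
Proof.
apply/eqP; rewrite -(@eqrXn2 _ 2%N) ?cabs_ge0// sqr_cabs /= expr1n.
by rewrite cos2Dsin2.
Qed.

Lemma integrableZ (a : R) (f : R -> R) : mu.-integrable I01 (EFin \o f) ->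
  mu.-integrable I01 (EFin \o (fun x => a * f x)).
Proof.
move=> h; have := @integrableZl _ _ _ mu I01 (measurable_itv _) a (EFin \o f) h.
exact: eq_integrable.
Qed.

Definition L2r (u : R -> R) : Prop := measurable_fun I01 u /\
  mu.-integrable I01 (EFin \o (fun x => u x ^+ 2)).

Lemma L2rM_integrable (u v : R -> R) : L2r u -> L2r v ->
  mu.-integrable I01 (EFin \o (fun x => u x * v x)).
Proof.
move=> [mu_ iu] [mv iv].
have iuv : mu.-integrable I01 ((EFin \o (fun x => u x ^+ 2)%R) \+ (EFin \o (fun
  x => v x ^+ 2)%R))%E.
  by apply: integrableD => //; exact: measurable_itv.
apply: le_integrable iuv => //.
  by apply/measurable_EFinP; exact: measurable_funM.
move=> x _ /=; rewrite lee_fin [leRHS]ger0_norm ?addr_ge0 ?sqr_ge0//.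
rewrite normrM -(real_normK (num_real (u x))) -(real_normK (num_real (v x))).
rewrite -subr_ge0 (_ : _ - _ = ((`|u x| - `|v x|) ^+ 2 + `|u x| ^+ 2 + `|v x|
  ^+ 2) / 2).
  by rewrite divr_ge0// !addr_ge0// sqr_ge0.
by field.
Qed.

Lemma L2r_lin (a b : R) (u v : R -> R) : L2r u -> L2r v ->
  L2r (fun x => a * u x + b * v x).
Proof.
move=> lu lv; split.
  by apply: measurable_funD; apply: measurable_funM => //;
    [exact: lu.1|exact: lv.1].
have h1 := integrableZ (a ^+ 2) lu.2.
have h2 := integrableZ (b ^+ 2) lv.2.
have h3 := integrableZ (2 * a * b) (L2rM_integrable lu lv).
have iD := @integrableD _ _ _ mu I01 (measurable_itv _).
have := iD _ _ (iD _ _ h1 h2) h3.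
apply: eq_integrable => // x _ /=.
by congr EFin; ring.
Qed.

Definition ipr (u v : R -> R) : R := Rintegral mu I01 (fun t => u t * v t).

Lemma iprC u v : ipr u v = ipr v u.
Proof. by apply: eq_Rintegral => x _; rewrite mulrC. Qed.

Lemma ipr_linr (a b : R) (u v w : R -> R) : L2r u -> L2r v -> L2r w ->
  ipr w (fun x => a * u x + b * v x) = a * ipr w u + b * ipr w v.
Proof.
move=> lu lv lw; have mI : measurable I01 by exact: measurable_itv.
have h1 := L2rM_integrable lw lu; have h2 := L2rM_integrable lw lv.
have k1 : mu.-integrable I01 (EFin \o (fun x => a * (w x * u x))).
  exact: integrableZ.
have k2 : mu.-integrable I01 (EFin \o (fun x => b * (w x * v x))).
  exact: integrableZ.
rewrite /ipr -!RintegralZl// -RintegralD//.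
by apply: eq_Rintegral => x _; ring.
Qed.

Definition L2c (f : R -> C) : Prop :=
  L2r (fun t => Re (f t)) /\ L2r (fun t => Im (f t)).

Lemma L2_01_L2c f : L2_01 f -> L2c f.
Proof.
move=> [mr mi fin].
have mI : measurable I01 by exact: measurable_itv.
have ic : mu.-integrable I01 (EFin \o (fun t => cabs (f t) ^+ 2)).
  apply/integrableP; split.
    rewrite (_ : (fun t => _) = fun t => Re (f t) ^+ 2 + Im (f t) ^+ 2).
      by apply/measurable_EFinP/measurable_funD; exact: measurable_funX.
    by apply/funext => t; rewrite sqr_cabs.
  under eq_integral do rewrite /= ger0_norm ?sqr_ge0//.
  exact: fin.
split; split => //; apply: le_integrable ic => //.
- by apply/measurable_EFinP; exact: measurable_funX.
- by move=> x _ /=; rewrite lee_fin !ger0_norm ?sqr_ge0// sqr_cabs lerDl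
    sqr_ge0.
- by apply/measurable_EFinP; exact: measurable_funX.
- by move=> x _ /=; rewrite lee_fin !ger0_norm ?sqr_ge0// sqr_cabs lerDr
    sqr_ge0.
Qed.

Lemma L2c_addscale (z : C) (f g : R -> C) : L2c f -> L2c g ->
  L2c (fun t => f t + z * g t).
Proof.
move=> [fr fi] [gr gi]; split.
- rewrite (_ : (fun t => _) = fun t => 1 * Re (f t) + 1 * (Re z * Re (g t) + (-
    Im z) * Im (g t))).
    by apply: L2r_lin => //; exact: L2r_lin.
  by apply/funext => t; rewrite !ReImE; ring.
- rewrite (_ : (fun t => _) = fun t => 1 * Im (f t) + 1 * (Re z * Im (g t) + Im
    z * Re (g t))).
    by apply: L2r_lin => //; exact: L2r_lin.
  by apply/funext => t; rewrite !ReImE; ring.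
Qed.

Lemma ip01E (f g : R -> C) : L2c f -> L2c g ->
  ip01 f g = complex.Complex
    (ipr (fun t => Re (f t)) (fun t => Re (g t)) + ipr (fun t => Im (f t)) (fun
      t => Im (g t)))
    (ipr (fun t => Im (f t)) (fun t => Re (g t)) - ipr (fun t => Re (f t)) (fun
      t => Im (g t))).
Proof.
move=> [fr fi] [gr gi]; have mI : measurable I01 by exact: measurable_itv.
rewrite /ip01 /ipr -RintegralD// -?RintegralB//; try exact: L2rM_integrable.
by congr complex.Complex; apply: eq_Rintegral => t _; rewrite !ReImE; ring.
Qed.

Lemma ip01C (f g : R -> C) : L2c f -> L2c g -> ip01 g f = conjc (ip01 f g).
Proof.
move=> lf lg; rewrite !ip01E//; apply: eq_ReIm; rewrite !ReImE/=.
  by congr (_ + _); exact: iprC.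
by rewrite opprB; congr (_ - _); exact: iprC.
Qed.

Lemma ip01_addscaler (z : C) (f g h : R -> C) : L2c f -> L2c g -> L2c h ->
  ip01 h (fun t => f t + z * g t) = ip01 h f + conjc z * ip01 h g.
Proof.
move=> lf lg lh; have lfg := L2c_addscale z lf lg.
rewrite !ip01E//; move: lf lg lh => [fr fi] [gr gi] [hr hi].
rewrite (_ : (fun t => Re (f t + z * g t)) =
   fun t => 1 * Re (f t) + 1 * (Re z * Re (g t) + (- Im z) * Im (g t)));
     last first.
  by apply/funext => t; rewrite !ReImE; ring.
rewrite (_ : (fun t => Im (f t + z * g t)) =
   fun t => 1 * Im (f t) + 1 * (Re z * Im (g t) + Im z * Re (g t))); last first.
  by apply/funext => t; rewrite !ReImE; ring.
rewrite !ipr_linr//; try exact: L2r_lin.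
by apply: eq_ReIm; rewrite !ReImE/=; ring.
Qed.

Lemma ip01_addscalel (z : C) (f g h : R -> C) : L2c f -> L2c g -> L2c h ->
  ip01 (fun t => f t + z * g t) h = ip01 f h + z * ip01 g h.
Proof.
move=> lf lg lh; have lfg := L2c_addscale z lf lg.
by rewrite (ip01C lh lfg) (ip01C lh lf) (ip01C lh lg) ip01_addscaler// conjcD
  conjcM complex.conjcK.
Qed.

Lemma norm2_ip (f : R -> C) : cR (norm2_01 f) = ip01 f f.
Proof.
apply: eq_ReIm => /=; rewrite /norm2_01.
  by apply: eq_Rintegral => t _; rewrite !ReImE sqr_cabs; ring.
rewrite (_ : (fun t => _) = cst 0); first by rewrite /Rintegral integral0.
by apply/funext => t; rewrite !ReImE /cst; ring.
Qed.

Definition wave (k : int) (t : R) : C := expi (2 * pi * (k%:~R * t)).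

Lemma wave_Re k : (fun t => Re (wave k t)) = trig_mono 1 0 k.
Proof. by apply/funext => t; rewrite /= /trig_mono; ring. Qed.

Lemma wave_Im k : (fun t => Im (wave k t)) = trig_mono 0 1 k.
Proof. by apply/funext => t; rewrite /= /trig_mono; ring. Qed.

Lemma L2r_bounded (K : R) (u : R -> R) : measurable_fun I01 u ->
  (forall x, `|u x| <= K) -> L2r u.
Proof.
move=> mu_ uK; split => //.
have mI : measurable I01 by exact: measurable_itv.
apply: le_integrable (integrable_I01_cst (K ^+ 2)) => //.
  by apply/measurable_EFinP; exact: measurable_funX.
move=> x _ /=; rewrite lee_fin !ger0_norm ?sqr_ge0//.
rewrite -(real_normK (num_real (u x))) lerXn2r ?nnegrE//.
by rewrite (le_trans _ (uK x)).
Qed.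

Lemma L2c_wave k : L2c (wave k).
Proof.
split; rewrite ?wave_Re ?wave_Im; apply: (@L2r_bounded (1 + 1)).
- by apply: measurable_trig_poly; exact: trig_poly_mono.
- by move=> x; rewrite (le_trans (trig_mono_bounded _ _ _ _))// normr1 normr0;
    lra.
- by apply: measurable_trig_poly; exact: trig_poly_mono.
- by move=> x; rewrite (le_trans (trig_mono_bounded _ _ _ _))// normr1 normr0;
    lra.
Qed.

Lemma is_derive_trig_mono a b k (x : R) :
  is_derive x 1 (trig_mono a b k)
    (trig_mono (2 * pi * k%:~R * b) (- (2 * pi * k%:~R * a)) k x).
Proof.
rewrite /trig_mono; apply: is_derive_eq.
rewrite /GRing.scale/=; ring.
Qed.

Lemma Rintegral_trig_mono a b k : k != 0 ->
  Rintegral mu I01 (trig_mono a b k) = 0.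
Proof.
move=> k0.
have c0 : 2 * pi * k%:~R != 0 :> R.
  by rewrite !mulf_neq0 ?intr_eq0// gt_eqF// pi_gt0.
set c := 2 * pi * k%:~R in c0.
pose F := trig_mono (- (b / c)) (a / c) k.
have E x : F^`()%classic x = trig_mono a b k x.
  rewrite derive1E (@derive_val _ _ _ _ _ _ _ (is_derive_trig_mono _ _ _ _)).
  by rewrite -/c /trig_mono; field.
rewrite /Rintegral (@continuous_FTC2 _ _ F 0 1)//.
- rewrite -EFinB /=; rewrite /F /trig_mono mulr0 mulr1 mulr0.
  have := expi_2pi_int k; rewrite /expi => -[-> ->].
  by rewrite cos0 sin0 subrr.
- by apply: continuous_subspaceT; exact: continuous_trig_mono.
- split.
  + by move=> x _; exact: (@ex_derive _ _ _ _ _ _ _ (is_derive_trig_mono _ _ _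
      _)).
  + by apply: cvg_at_right_filter; exact: continuous_trig_mono.
  + by apply: cvg_at_left_filter; exact: continuous_trig_mono.
Qed.

Lemma ip01_wave k l : ip01 (wave k) (wave l) = (k == l)%:R.
Proof.
have E t : wave k t * conjc (wave l t) = wave (k - l) t.
  by rewrite conj_expi -expiD; congr expi; rewrite intrB; ring.
rewrite /ip01; under eq_Rintegral do rewrite E.
rewrite (_ : (fun t => Im _) = fun t => Im (wave (k - l) t)); last first.
  by apply/funext => t; rewrite E.
rewrite wave_Re wave_Im.
have [->|kl] := eqVneq k l; last first.
  by rewrite !Rintegral_trig_mono ?subr_eq0.
rewrite subrr; apply: eq_ReIm => /=.
  rewrite (_ : trig_mono 1 0 0 = cst 1) ?Rintegral_cst//=; last first.
    by apply/funext => t; rewrite /trig_mono mul0r mulr0 cos0 /cst; ring.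
  by rewrite lebesgue_measure_itv/= lte_fin ltr01 sube0/= mul1r.
rewrite (_ : trig_mono 0 1 0 = cst 0); first by rewrite /Rintegral integral0.
by apply/funext => t; rewrite /trig_mono (mul0r t) mulr0 sin0 /cst; ring.
Qed.

Definition fcoef (f : R -> C) (k : int) : C := ip01 f (wave k).

Lemma L2c_sum (I : Type) (r : seq I) (al : I -> C) (g : I -> R -> C) :
  (forall i, L2c (g i)) -> L2c (fun t => \sum_(i <- r) al i * g i t).
Proof.
move=> lg; elim: r => [|k r ih].
  under eq_fun do rewrite big_nil.
  by split; apply: (@L2r_bounded 0) => //; move=> *; rewrite normr0.
under eq_fun do rewrite big_cons addrC.
exact: L2c_addscale.
Qed.

Lemma norm2_sub_wave f (z : C) k : L2c f ->
  norm2_01 (fun t => f t + (- z) * wave k t) =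
  norm2_01 f - cabs (fcoef f k) ^+ 2 + cabs (z - fcoef f k) ^+ 2.
Proof.
move=> lf; have lw := L2c_wave k; have lfw := L2c_addscale (- z) lf lw.
apply: cR_inj; rewrite norm2_ip !cRD cRN !cR_sqr_cabs norm2_ip.
rewrite ip01_addscaler// !ip01_addscalel// ip01_wave eqxx mulr1n.
rewrite (ip01C lf lw) -/(fcoef f k).
have -> : conjc (- z) = - conjc z by apply: eq_ReIm; case: (z).
have -> : conjc (z - fcoef f k) = conjc z - conjc (fcoef f k).
  by rewrite conjcD; congr (_ + _); apply: eq_ReIm; case: (fcoef f k).
ring.
Qed.

Lemma fcoef_sub_wave f (z : C) k l : L2c f -> l != k ->
  fcoef (fun t => f t + (- z) * wave k t) l = fcoef f l.
Proof.
move=> lf lk; rewrite /fcoef ip01_addscalel//; [|exact: L2c_wave..].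
by rewrite ip01_wave eq_sym (negbTE lk) mulr0 addr0.
Qed.

Lemma norm2_sub_waves (r : seq int) (al : int -> C) f : L2c f -> uniq r ->
  norm2_01 (fun t => f t - \sum_(k <- r) al k * wave k t) =
  norm2_01 f - \sum_(k <- r) cabs (fcoef f k) ^+ 2
  + \sum_(k <- r) cabs (al k - fcoef f k) ^+ 2.
Proof.
elim: r f => [|k r ih] f lf.
  move=> _; rewrite !big_nil subr0 addr0; congr norm2_01.
  by apply/funext => t; rewrite big_nil subr0.
move=> /= /andP[kr ur].
have lfw := L2c_addscale (- al k) lf (L2c_wave k).
have := ih _ lfw ur; rewrite norm2_sub_wave//.
have nek l : l \in r -> l != k by move=> lr; apply: contraNneq kr => <-.
have E1 : \sum_(l <- r) cabs (fcoef (fun t => f t + - al k * wave k t) l) ^+ 2 =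
    \sum_(l <- r) cabs (fcoef f l) ^+ 2.
  by apply: eq_big_seq => l lr; rewrite fcoef_sub_wave// nek.
have E2 : \sum_(l <- r) cabs (al l - fcoef (fun t => f t + - al k * wave k t)
  l) ^+ 2 =
    \sum_(l <- r) cabs (al l - fcoef f l) ^+ 2.
  by apply: eq_big_seq => l lr; rewrite fcoef_sub_wave// nek.
rewrite E1 E2 !big_cons => E.
rewrite [X in norm2_01 X](_ : _ = fun t => f t + - al k * wave k t - \sum_(k <-
  r) al k * wave k t).
  by rewrite E opprD !addrA; congr (_ + _); rewrite addrAC.
by apply/funext => t; rewrite big_cons; ring.
Qed.

Fixpoint freqs (n : nat) : seq int :=
  if n is n'.+1 then
    freqs n' ++ ([seq Posz k | k <- iota (2 ^ n') (2 ^ n')] ++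
                 [seq - Posz k | k <- iota (2 ^ n') (2 ^ n')])
  else [:: 0].

Lemma mem_freqs n (k : int) : (k \in freqs n) = (`|k| < 2 ^ n)%N.
Proof.
elim: n => [|n ih] /=; first by rewrite inE expn0; lia.
have p0 : (0 < 2 ^ n)%N by rewrite expn_gt0.
rewrite !mem_cat ih expnS; apply/idP/idP.
  case/or3P => [|/mapP[m]|/mapP[m]]; first by lia.
  - by rewrite mem_iota => /andP[h1 h2] ->; lia.
  - by rewrite mem_iota => /andP[h1 h2] ->; lia.
move=> {ih} h; have [//|h2] := ltnP `|k| (2 ^ n); rewrite /=; apply/orP.
case: k h h2 => m h h2; [left|right]; apply/mapP.
  by exists m => //; rewrite mem_iota; lia.
by exists m.+1 => //; rewrite mem_iota; lia.
Qed.

Lemma freqs_uniq n : uniq (freqs n).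
Proof.
elim: n => //= n ih.
have p0 : (0 < 2 ^ n)%N by rewrite expn_gt0.
rewrite !cat_uniq ih /= !map_inj_uniq ?iota_uniq//=; last 2 first.
- by move=> x y []; lia.
- by move=> x y []; lia.
rewrite andbT; apply/andP; split; apply/hasPn => x.
  rewrite mem_cat mem_freqs -leqNgt => /orP[] /mapP[m];
    rewrite mem_iota => /andP[h1 h2] ->; lia.
move=> /mapP[m]; rewrite mem_iota => /andP[h1 h2] ->.
by apply/negP => /mapP[m']; rewrite mem_iota => /andP[h3 h4]; lia.
Qed.

Lemma sum_delta (r : seq int) k (F : int -> C) : uniq r -> k \in r ->
  \sum_(j <- r) (j == k)%:R * F j = F k.
Proof.
move=> ur kr; rewrite (bigD1_seq k)//= eqxx mul1r big1 ?addr0// => j /negbTE ->.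
by rewrite mul0r.
Qed.

Lemma trig_poly_waves (T : R -> R) : trig_poly T ->
  exists n0, forall n, (n0 <= n)%N -> exists al : int -> C, forall t,
    cR (T t) = \sum_(k <- freqs n) al k * wave k t.
Proof.
elim => [|f a b k _ [n0 ih]].
  by exists 0%N => n _; exists (fun=> 0) => t; rewrite big1// => k _;
    rewrite mul0r.
exists (maxn n0 `|k|) => n; rewrite geq_max => /andP[/ih[al hal] kn].
pose z1 : C := complex.Complex (a / 2) (- (b / 2)).
pose z2 : C := complex.Complex (a / 2) (b / 2).
exists (fun j => al j + ((j == k)%:R * z1 + (j == - k)%:R * z2)) => t.
under eq_bigr do rewrite mulrDl mulrDl -!mulrA.
rewrite !big_split/= -hal cRD; congr (_ + _).
have kn' : (`|k| < 2 ^ n)%N by rewrite (leq_ltn_trans kn)// ltn_expl.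
rewrite (sum_delta (fun j => z1 * wave j t)) ?freqs_uniq ?mem_freqs//.
rewrite (sum_delta (fun j => z2 * wave j t)) ?freqs_uniq ?mem_freqs ?abszN//.
rewrite /wave intrN mulNr mulrN -conj_expi.
by apply: eq_ReIm; rewrite !ReImE /= /trig_mono; field.
Qed.

Lemma L2c_approx_waves (f : R -> C) (e : R) : L2c f -> 0 < e ->
  exists n0, forall n, (n0 <= n)%N -> exists al : int -> C,
    norm2_01 (fun t => f t - \sum_(k <- freqs n) al k * wave k t) <= e.
Proof.
move=> [[mr ir] [mi ii]] e0; have e2 : 0 < e / 2 by rewrite divr_gt0.
have [_ /(_ _ e2) [T1 tT1 d1]] := trig_approx_L2 mr ir.
have [_ /(_ _ e2) [T2 tT2 d2]] := trig_approx_L2 mi ii.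
have [n1 h1] := trig_poly_waves tT1; have [n2 h2] := trig_poly_waves tT2.
exists (maxn n1 n2) => n; rewrite geq_max => /andP[/h1[al1 E1] /h2[al2 E2]].
exists (fun k => al1 k + complex.Complex 0 1 * al2 k).
rewrite (_ : (fun t => _) = fun t => f t - complex.Complex (T1 t) (T2 t));
  last first.
  apply/funext => t; congr (_ - _).
  under eq_bigr do rewrite mulrDl -mulrA.
  rewrite big_split/= -mulr_sumr -E1 -E2.
  by apply: eq_ReIm; rewrite !ReImE/=; ring.
have -> : e = fine e%:E by [].
have mT1 := @measurable_trig_poly R I01 _ tT1.
have mT2 := @measurable_trig_poly R I01 _ tT2.
have m1 := measurable_sqr_dist mr mT1.
have m2 := measurable_sqr_dist mi mT2.
have E : (\int[mu]_(t in I01) (cabs (f t - complex.Complex (T1 t) (T2 t)) ^+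
  2)%:E =
   dist2 (fun t => Re (f t)) T1 + dist2 (fun t => Im (f t)) T2)%E.
  rewrite /dist2 -ge0_integralD//.
  - by apply: eq_integral => t _; rewrite -EFinD sqr_cabs; case: (f t).
  - by move=> x _; rewrite lee_fin sqr_ge0.
  - by move=> x _; rewrite lee_fin sqr_ge0.
have le : (\int[mu]_(t in I01) (cabs (f t - complex.Complex (T1 t) (T2 t)) ^+
  2)%:E <= e%:E)%E.
  by rewrite E [e in leRHS]splitr EFinD leeD.
rewrite /norm2_01 /Rintegral; apply: fine_le => //.
rewrite ge0_fin_numE; first by rewrite (le_lt_trans le)// ltry.
by apply: integral_ge0 => t _; rewrite lee_fin sqr_ge0.
Qed.

Lemma norm2_ge0 (f : R -> C) : 0 <= norm2_01 f.
Proof. by apply: Rintegral_ge0 => t _; rewrite sqr_ge0. Qed.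

Lemma bessel (f : R -> C) n : L2c f ->
  \sum_(k <- freqs n) cabs (fcoef f k) ^+ 2 <= norm2_01 f.
Proof.
move=> lf; rewrite -subr_ge0.
have := norm2_ge0 (fun t => f t - \sum_(k <- freqs n) fcoef f k * wave k t).
rewrite (norm2_sub_waves (fcoef f) lf (freqs_uniq n)).
rewrite [X in _ + X]big1 ?addr0// => k _.
by rewrite subrr sqr_cabs /= expr0n/= addr0.
Qed.

Lemma parseval_lower (f : R -> C) (e : R) : L2c f -> 0 < e ->
  exists n0, forall n, (n0 <= n)%N ->
  norm2_01 f <= \sum_(k <- freqs n) cabs (fcoef f k) ^+ 2 + e.
Proof.
move=> lf e0; have [n0 h] := L2c_approx_waves lf e0.
exists n0 => n /h[al]; rewrite (norm2_sub_waves al lf (freqs_uniq n)) => le.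
have : 0 <= \sum_(k <- freqs n) cabs (al k - fcoef f k) ^+ 2.
  by apply: sumr_ge0 => k _; exact: sqr_ge0.
by move: le; lra.
Qed.

End FourierCoefficients.

(** * The window-adapted frame *)

Section WindowFrame.
Set Implicit Arguments.
Unset Strict Implicit.
Variable R : realType.
Local Notation mu := (@lebesgue_measure R).
Local Notation I01 := (`[0%R, 1%R]%classic : set R).
Local Notation C := (complex.complex R).
Local Notation Re := complex.Re.
Local Notation Im := complex.Im.
Local Notation conjc := complex.conjc.

Lemma ip01_sumr (I : Type) (r : seq I) (al : I -> C) (g : I -> R -> C) f :
  L2c f -> (forall i, L2c (g i)) ->
  ip01 f (fun t => \sum_(i <- r) al i * g i t) =
  \sum_(i <- r) conjc (al i) * ip01 f (g i).
Proof.
move=> lf lg; elim: r => [|i r ih].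
  rewrite big_nil; under eq_fun do rewrite big_nil.
  rewrite /ip01 (_ : (fun t => Re _) = cst 0); last first.
    by apply/funext => t; rewrite !ReImE/= /cst; ring.
  rewrite (_ : (fun t => Im _) = cst 0); last first.
    by apply/funext => t; rewrite !ReImE/= /cst; ring.
  by rewrite /Rintegral integral0.
under eq_fun do rewrite big_cons addrC.
by rewrite ip01_addscaler//; [rewrite ih big_cons addrC|exact: L2c_sum].
Qed.

Lemma ip01_scaler (z : C) (f g : R -> C) : L2c f -> L2c g ->
  ip01 f (fun t => g t * z) = conjc z * ip01 f g.
Proof.
move=> lf lg; have := @ip01_sumr unit [:: tt] (fun=> z) (fun=> g) f lf (fun=>
  lg).
rewrite big_seq1 => <-; congr ip01.
by apply/funext => t; rewrite big_seq1 mulrC.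
Qed.

Lemma norm2_sum_waves (n : nat) (al : 'I_n -> C) (k : 'I_n -> int) : injective
  k ->
  norm2_01 (fun t => \sum_(i < n) al i * wave (k i) t) =
  \sum_(i < n) cabs (al i) ^+ 2.
Proof.
move=> ki; set f := (fun t => _).
have lw i : L2c (@wave R (k i)) by exact: L2c_wave.
have lf : L2c f by exact: L2c_sum.
apply: cR_inj; rewrite norm2_ip cR_sum {2}/f ip01_sumr//.
apply: eq_bigr => i _; rewrite cR_sqr_cabs mulrC; congr (_ * _).
rewrite (ip01C (lw i) lf) ip01_sumr// conjc_sum (bigD1 i)//= big1 ?addr0.
  by rewrite ip01_wave eqxx mulr1 complex.conjcK.
move=> j ji; rewrite ip01_wave (inj_eq ki) eq_sym (negbTE ji) mulr0.
by apply: eq_ReIm; rewrite !ReImE//= oppr0.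
Qed.

Lemma expiX (a : R) n : expi a ^+ n = expi (a * n%:R).
Proof.
elim: n => [|n ih]; first by rewrite mulr0 expi0.
by rewrite exprS ih -expiD -[n.+1]add1n natrD; congr expi; ring.
Qed.

Lemma expi_neq1 (a : R) : a != 0 -> `|a| < 2 * pi -> expi a != 1.
Proof.
move=> a0 a2; apply/eqP => -[c1 _].
have : cos `|a| = 1.
  by case: (lerP 0 a) => h; [rewrite ger0_norm|rewrite ltr0_norm// cosN].
have -> : `|a| = (`|a| / 2) *+ 2 by rewrite -mulr_natr; field.
rewrite cos_mulr2n => h.
have s0 : 0 < sin (`|a| / 2).
  apply: sin_gt0_pi; rewrite divr_gt0 ?normr_gt0//=.
  by rewrite ltr_pdivrMr// mulrC.
have := cos2Dsin2 (`|a| / 2).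
have : 0 < sin (`|a| / 2) ^+ 2 by rewrite exprn_gt0.
move: h; rewrite -mulr_natr; lra.
Qed.

Lemma sum_expi_root (b : nat) (i j : 'I_b) :
  \sum_(tau < b) expi (2 * pi * ((i%:R - j%:R) / b%:R) * tau%:R) =
  (i == j)%:R * b%:R :> C.
Proof.
have b0 : (0 < b)%N by exact: leq_ltn_trans (ltn_ord i).
have b0' : b%:R != 0 :> R by rewrite pnatr_eq0 -lt0n.
have [->|ij] := eqVneq i j.
  under eq_bigr do rewrite subrr mul0r mulr0 mul0r expi0.
  by rewrite sumr_const card_ord mul1r.
rewrite mul0r; set x := 2 * pi * _.
under eq_bigr do rewrite -expiX.
have x1 : expi x != 1.
  apply: expi_neq1.
    rewrite /x !mulf_neq0 ?invr_eq0 ?subr_eq0 ?eqr_nat//.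
    by rewrite gt_eqF// pi_gt0.
  rewrite /x normrM ger0_norm ?mulr_ge0 ?pi_ge0// gtr_pMr ?mulr_gt0 ?pi_gt0//.
  rewrite normrM normfV (ger0_norm (ler0n _ b)) ltr_pdivrMr ?ltr0n// mul1r.
  have := ltn_ord i; have := ltn_ord j; rewrite -(ltr_nat R) -[(i <
    b)%N](ltr_nat R).
  have := ler0n R i; have := ler0n R j; rewrite ltr_norml; lra.
have : (expi x - 1) * (\sum_(i0 < b) expi x ^+ i0) = 0.
  rewrite -subrX1 expiX.
  have -> : x * b%:R = 2 * pi * (i%:Z - j%:Z)%:~R.
    by rewrite intrB /x; field.
  by rewrite expi_2pi_int subrr.
by move/eqP; rewrite mulf_eq0 subr_eq0 (negbTE x1) => /eqP.
Qed.

Lemma sum_sqr_dft (b : nat) (y : 'I_b -> C) :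
  \sum_(tau < b) cabs (\sum_(j < b)
     y j * expi (2 * pi * ((b + j)%:R * (tau%:R / b%:R)))) ^+ 2 =
  b%:R * \sum_(j < b) cabs (y j) ^+ 2.
Proof.
case: b y => [|b'] y; first by rewrite !big_ord0 mulr0.
set b := b'.+1.
have b0' : b%:R != 0 :> R by rewrite pnatr_eq0.
apply: cR_inj; rewrite cR_sum cRM.
transitivity (\sum_(tau < b) \sum_(i < b) \sum_(j < b)
   (y i * conjc (y j)) * expi (2 * pi * ((i%:R - j%:R) / b%:R) * tau%:R)).
  apply: eq_bigr => tau _; rewrite cR_sqr_cabs conjc_sum mulr_suml.
  apply: eq_bigr => i _; rewrite mulr_sumr; apply: eq_bigr => j _.
  rewrite conjcM conj_expi mulrACA -expiD; congr (_ * expi _).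
  by rewrite !natrD; field.
rewrite exchange_big/= cR_sum mulr_sumr; apply: eq_bigr => i _.
rewrite exchange_big/= (bigD1 i)//= [X in _ + X]big1 ?addr0 => [|j ji].
  rewrite -mulr_sumr sum_expi_root eqxx mul1r cR_sqr_cabs mulrC; congr (_ * _).
  by elim: (b) => // m ihm; rewrite -[m.+1]addn1 !natrD cRD ihm.
by rewrite -mulr_sumr sum_expi_root eq_sym (negbTE ji) mul0r mulr0.
Qed.

Lemma betaS n : beta n.+1 = (2 ^ n)%N.
Proof. by case: n. Qed.

Definition Ecoef (phihat : R -> C) n (tau : nat) (j : nat) : C :=
  cR (Num.sqrt (2 ^ n)%:R)^-1 * ((cphi phihat n.+1 j)^-1 *
    expi (- (2 * pi * ((2 ^ n + j)%:R * (tau%:R / (2 ^ n)%:R))))).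

Lemma EposE (phihat : R -> C) n tau :
  Epos phihat n.+1 tau = fun t => \sum_(j < 2 ^ n) Ecoef phihat n tau j *
    wave (Posz (2 ^ n + j)) t.
Proof.
apply/funext => t; rewrite /Epos betaS mulr_sumr; apply: eq_bigr => j _.
rewrite /Ecoef -!mulrA; congr (_ * (_ * _)); rewrite -expiD; congr expi.
by ring.
Qed.

Lemma conj_EposE (phihat : R -> C) n tau :
  (fun t => conjc (Epos phihat n.+1 tau t)) =
  fun t => \sum_(j < 2 ^ n) conjc (Ecoef phihat n tau j) *
    wave (- Posz (2 ^ n + j)) t.
Proof.
apply/funext => t; rewrite EposE conjc_sum; apply: eq_bigr => j _.
by rewrite conjcM; congr (_ * _); rewrite conj_expi /wave intrN mulNr mulrN.
Qed.

Lemma cabs_inv (z : C) : cabs z^-1 = (cabs z)^-1.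
Proof.
have [->|z0] := eqVneq z 0.
  by rewrite invr0 /cabs /= expr0n/= addr0 sqrtr0 invr0.
have h : cabs z * cabs z^-1 = 1.
  by rewrite -cabsM divff// /cabs /= expr0n/= addr0 expr1n sqrtr1.
have c0 : cabs z != 0 by apply: contra_eq_neq h => ->;
  rewrite mul0r eq_sym oner_neq0.
by apply: (mulfI c0); rewrite h divff.
Qed.

Lemma sqr_cabs_cR (x : R) : cabs (cR x) ^+ 2 = x ^+ 2.
Proof. by rewrite sqr_cabs /= expr0n addr0. Qed.

Lemma sqr_cabs_Ecoef (phihat : R -> C) n tau j :
  cabs (Ecoef phihat n tau j) ^+ 2 =
  ((2 ^ n)%:R)^-1 * cabs (cphi phihat n.+1 j) ^- 2.
Proof.
rewrite /Ecoef !cabsM cabs_expi mulr1 cabs_inv exprMn sqr_cabs_cR exprVn.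
by rewrite sqr_sqrtr ?ler0n// exprVn.
Qed.

Definition Enorm2 (phihat : R -> C) n : R :=
  ((2 ^ n)%:R)^-1 * \sum_(j < 2 ^ n) cabs (cphi phihat n.+1 j) ^- 2.

Lemma norm2_Epos (phihat : R -> C) n tau :
  norm2_01 (Epos phihat n.+1 tau) = Enorm2 phihat n.
Proof.
rewrite EposE norm2_sum_waves; last by move=> i j []/eqP;
  rewrite eqn_add2l => /eqP/val_inj.
by rewrite /Enorm2 mulr_sumr; apply: eq_bigr => j _; exact: sqr_cabs_Ecoef.
Qed.

Lemma norm2_conj (f : R -> C) : norm2_01 (fun t => conjc (f t)) = norm2_01 f.
Proof. by apply: eq_Rintegral => t _; rewrite cabs_conj. Qed.

Lemma L2c_Epos (phihat : R -> C) n tau : L2c (Epos phihat n.+1 tau).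
Proof. by rewrite EposE; apply: L2c_sum => i; exact: L2c_wave. Qed.

Lemma L2c_conj_Epos (phihat : R -> C) n tau :
  L2c (fun t => conjc (Epos phihat n.+1 tau t)).
Proof. by rewrite conj_EposE; apply: L2c_sum => i; exact: L2c_wave. Qed.

Lemma sum_sqr_ip_Epos (phihat : R -> C) f n : L2c f ->
  \sum_(tau < 2 ^ n) cabs (ip01 f (Epos phihat n.+1 tau)) ^+ 2 =
  \sum_(j < 2 ^ n) cabs (cphi phihat n.+1 j) ^- 2 *
     cabs (fcoef f (Posz (2 ^ n + j))) ^+ 2.
Proof.
move=> lf; have b0 : (2 ^ n)%:R != 0 :> R by rewrite pnatr_eq0 expn_eq0.
pose y j := conjc (cphi phihat n.+1 j)^-1 * fcoef f (Posz (2 ^ n + j)).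
transitivity (\sum_(tau < 2 ^ n) ((2 ^ n)%:R)^-1 * cabs (\sum_(j < 2 ^ n)
     y j * expi (2 * pi * ((2 ^ n + j)%:R * (tau%:R / (2 ^ n)%:R)))) ^+ 2).
  apply: eq_bigr => tau _.
  rewrite EposE ip01_sumr//; last by move=> i; exact: L2c_wave.
  rewrite (eq_bigr (fun j : 'I__ => cR (Num.sqrt (2 ^ n)%:R)^-1 *
     (y j * expi (2 * pi * ((2 ^ n + j)%:R * (tau%:R / (2 ^ n)%:R)))))).
    rewrite -mulr_sumr cabsM exprMn sqr_cabs_cR exprVn sqr_sqrtr ?ler0n//.
  move=> j _; rewrite /Ecoef !conjcM conj_cR conj_expi opprK /y /fcoef.
  by rewrite -!mulrA; congr (_ * (_ * _)); rewrite mulrC.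
rewrite -mulr_sumr (sum_sqr_dft (fun j => y j)) mulrA mulVf// mul1r.
apply: eq_bigr => j _; rewrite /y cabsM cabs_conj cabs_inv exprMn exprVn//.
Qed.

Lemma sum_sqr_ip_conj_Epos (phihat : R -> C) f n : L2c f ->
  \sum_(tau < 2 ^ n) cabs (ip01 f (fun t => conjc (Epos phihat n.+1 tau t))) ^+
    2 =
  \sum_(j < 2 ^ n) cabs (cphi phihat n.+1 j) ^- 2 *
     cabs (fcoef f (- Posz (2 ^ n + j))) ^+ 2.
Proof.
move=> lf; have b0 : (2 ^ n)%:R != 0 :> R by rewrite pnatr_eq0 expn_eq0.
pose y j := conjc ((cphi phihat n.+1 j)^-1 * fcoef f (- Posz (2 ^ n + j))).
transitivity (\sum_(tau < 2 ^ n) ((2 ^ n)%:R)^-1 * cabs (\sum_(j < 2 ^ n)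
     y j * expi (2 * pi * ((2 ^ n + j)%:R * (tau%:R / (2 ^ n)%:R)))) ^+ 2).
  apply: eq_bigr => tau _.
  rewrite conj_EposE ip01_sumr//; last by move=> i; exact: L2c_wave.
  rewrite -cabs_conj conjc_sum.
  rewrite (eq_bigr (fun j : 'I__ => cR (Num.sqrt (2 ^ n)%:R)^-1 *
     (y j * expi (2 * pi * ((2 ^ n + j)%:R * (tau%:R / (2 ^ n)%:R)))))).
    rewrite -mulr_sumr cabsM exprMn sqr_cabs_cR exprVn sqr_sqrtr ?ler0n//.
  move=> j _; rewrite /Ecoef !conjcM !complex.conjcK conj_cR conj_expi opprK /y
    /fcoef.
  by rewrite conjcM -!mulrA; congr (_ * (_ * _)); rewrite mulrC.
rewrite -mulr_sumr (sum_sqr_dft (fun j => y j)) mulrA mulVf// mul1r.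
apply: eq_bigr => j _; rewrite /y cabs_conj cabsM cabs_inv exprMn exprVn//.
Qed.

Lemma sqr_cabs_ip_div (f g : R -> C) (N : R) : L2c f -> L2c g -> 0 <= N ->
  cabs (ip01 f (fun t => g t / cR (Num.sqrt N))) ^+ 2 = N^-1 * cabs (ip01 f g)
    ^+ 2.
Proof.
move=> lf lg N0; rewrite ip01_scaler// cabsM exprMn cabs_conj cabs_inv exprVn.
by rewrite sqr_cabs_cR sqr_sqrtr.
Qed.

Lemma weighted_sum_bounds (n : nat) (delta M N : R) (c x : 'I_n -> R) :
  (0 < n)%N -> 0 < delta -> (forall j, delta <= c j <= M) ->
  (forall j, 0 <= x j) ->
  N = n%:R^-1 * \sum_(j < n) c j ^- 2 ->
  (delta / M) ^+ 2 * \sum_(j < n) x j <= N^-1 * \sum_(j < n) c j ^- 2 * x j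
    <= (M / delta) ^+ 2 * \sum_(j < n) x j.
Proof.
move=> n0 d0 hc x0 NE.
have cd j : M ^- 2 <= c j ^- 2 <= delta ^- 2.
  have /andP[h1 h2] := hc j.
  have c0 : 0 < c j by exact: lt_le_trans h1.
  have M0 : 0 < M by exact: lt_le_trans h2.
  by apply/andP; split; rewrite lef_pV2 ?posrE ?exprn_gt0// lerXn2r ?nnegrE
    ?(ltW d0) ?(ltW c0) ?(ltW M0).
have M0 : 0 < M.
  have /andP[h1 h2] := hc (Ordinal n0).
  by rewrite (lt_le_trans d0)// (le_trans h1).
have n0' : 0 < n%:R :> R by rewrite ltr0n.
have NM : M ^- 2 <= N.
  rewrite NE ler_pdivlMl// (_ : n%:R * _ = \sum_(j < n) M ^- 2).
    by apply: ler_sum => j _; have /andP[] := cd j.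
  by rewrite sumr_const card_ord mulr_natl.
have Nd : N <= delta ^- 2.
  rewrite NE ler_pdivrMl// (_ : n%:R * _ = \sum_(j < n) delta ^- 2).
    by apply: ler_sum => j _; have /andP[] := cd j.
  by rewrite sumr_const card_ord mulr_natl.
have N0 : 0 < N by rewrite (lt_le_trans _ NM)// invr_gt0 exprn_gt0.
have NV1 : delta ^+ 2 <= N^-1.
  by rewrite -[leLHS]invrK lef_pV2 ?posrE ?invr_gt0 ?exprn_gt0.
have NV2 : N^-1 <= M ^+ 2.
  by rewrite -[leRHS]invrK lef_pV2 ?posrE ?invr_gt0 ?exprn_gt0.
have s0 : 0 <= \sum_(j < n) x j by apply: sumr_ge0.
rewrite !expr_div_n; apply/andP; split.
  rewrite -[leLHS]mulrA; apply: (ler_pM (sqr_ge0 _) _ NV1);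
    first by rewrite mulr_ge0// invr_ge0 sqr_ge0.
  rewrite mulr_sumr; apply: ler_sum => j _; apply: ler_wpM2r => //.
  by have /andP[] := cd j.
rewrite -[leRHS]mulrA; apply: (ler_pM _ _ NV2); first by rewrite invr_ge0 ltW.
  apply: sumr_ge0 => j _; apply: mulr_ge0 => //.
  by have /andP[+ _] := cd j; apply: le_trans; rewrite invr_ge0 sqr_ge0.
rewrite mulr_sumr; apply: ler_sum => j _; apply: ler_wpM2r => //.
by have /andP[] := cd j.
Qed.

Lemma phihat_ext_bounds (phihat : R -> C) (delta M x : R) :
  cvg ((fun x => Re (phihat x)) @ (- (1/3))^'+) ->
  cvg ((fun x => Im (phihat x)) @ (- (1/3))^'+) ->
  0 < delta ->
  (forall x : R, - (1/3) < x < 1/3 -> delta <= cabs (phihat x)) ->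
  (forall x : R, - (1/3) < x < 1/3 -> cabs (phihat x) <= M) ->
  - (1/3) <= x < 1/3 -> delta <= cabs (phihat_ext phihat x) <= M.
Proof.
move=> cr ci d0 hd hM /andP[x1 x2]; rewrite /phihat_ext.
case: eqVneq => [_|xn]; last by rewrite hd ?hM// x2 lt_neqAle eq_sym xn x1.
have M0 : 0 < M.
  have z : - (1/3) < (0 : R) < 1/3 by apply/andP; split; lra.
  by rewrite (lt_le_trans d0)// (le_trans (hd 0 z))// hM.
set a := lim _; set b := lim _.
pose g y := Re (phihat y) ^+ 2 + Im (phihat y) ^+ 2.
have cg : g y @[y --> (- (1/3))^'+] --> a ^+ 2 + b ^+ 2.
  rewrite !expr2; apply: cvgD.
    by under eq_fun do rewrite expr2; apply: cvgM.
  by under eq_fun do rewrite expr2; apply: cvgM.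
have near_in : \forall y \near (- (1/3) : R)^'+, - (1/3) < y < 1/3.
  near=> y; apply/andP; split; near: y; first exact: nbhs_right_gt.
  by apply: nbhs_right_lt; lra.
have l1 : delta ^+ 2 <= a ^+ 2 + b ^+ 2.
  apply: (@ler_cvg_to _ _ _ R (fun=> delta ^+ 2) g _ _ (cvg_cst _) cg).
  apply: filterS near_in => y y13; rewrite /g -sqr_cabs lerXn2r ?nnegrE
    ?cabs_ge0 ?hd//.
  exact: ltW.
have l2 : a ^+ 2 + b ^+ 2 <= M ^+ 2.
  apply: (@ler_cvg_to _ _ _ R g (fun=> M ^+ 2) _ _ cg (cvg_cst _)).
  apply: filterS near_in => y y13; rewrite /g -sqr_cabs lerXn2r ?nnegrE
    ?cabs_ge0 ?hM//.
  exact: ltW.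
by apply/andP; split; rewrite -(@ler_pXn2r _ 2%N) ?nnegrE ?cabs_ge0 ?(ltW d0)
  ?(ltW M0)// sqr_cabs.
Unshelve. all: by end_near. Qed.

Lemma cphi_arg_bounds n j : (j < 2 ^ n)%N ->
  - (1/3) <= ((beta n.+1 + j)%:R / (nu n.+1)%:R - 1 : R) < 1/3.
Proof.
case: n => [|n] jn.
  move: jn; rewrite expn0 ltnS leqn0 => /eqP ->.
  by rewrite /beta /nu addn0 divff// subrr; apply/andP; split; lra.
rewrite expnS in jn.
have -> : beta n.+2 = (2 * 2 ^ n)%N by rewrite /beta /= expnS.
have -> : nu n.+2 = (2 * 2 ^ n + 2 ^ n)%N by rewrite /nu /= expnS.
set m := (2 ^ n)%N in jn *.
have m0 : (0 < m)%N by rewrite expn_gt0.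
have m0' : 0 < m%:R :> R by rewrite ltr0n.
have j0 : 0 <= j%:R :> R by [].
have jm : j%:R < 2 * m%:R :> R by rewrite -natrM ltr_nat.
rewrite (natrD _ (2 * m) j) (natrD _ (2 * m) m) (natrM _ 2 m).
have -> : 2 * m%:R + m%:R = 3 * m%:R :> R by ring.
rewrite lerBrDr ltrBlDr ler_pdivlMr ?ltr_pdivrMr ?mulr_gt0//.
by apply/andP; split; lra.
Qed.

Lemma cphi_bounds (phihat : R -> C) (delta M : R) n j :
  (forall x : R, - (1/3) <= x < 1/3 -> delta <= cabs (phihat_ext phihat x) <=
    M) ->
  (j < 2 ^ n)%N -> delta <= cabs (cphi phihat n.+1 j) <= M.
Proof. by move=> h jn; rewrite /cphi cabs_conj; apply: h;
  exact: cphi_arg_bounds. Qed.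

Definition block_sum (phihat f : R -> C) (p : int) : R :=
  \sum_(tau < beta `|p|%N) cabs (ip01 f (Fphi phihat p tau)) ^+ 2.

Definition level_sum (phihat f : R -> C) (n : nat) : R :=
  if n is n'.+1 then block_sum phihat f (Posz n) + block_sum phihat f (Negz n')
  else block_sum phihat f 0.

Definition level_energy (f : R -> C) (n : nat) : R :=
  if n is n'.+1 then
    \sum_(j < 2 ^ n') cabs (fcoef f (Posz (2 ^ n' + j))) ^+ 2 +
    \sum_(j < 2 ^ n') cabs (fcoef f (- Posz (2 ^ n' + j))) ^+ 2
  else cabs (fcoef f 0) ^+ 2.

Lemma sum_iota (b c : nat) (F : nat -> R) :
  \sum_(k <- iota b c) F k = \sum_(j < c) F (b + j)%N.
Proof.
rewrite -{1}[b]addn0 iotaDl big_map.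
by rewrite -(big_mkord xpredT (fun j => F (b + j)%N)) /index_iota subn0.
Qed.

Lemma sum_level_energy f n :
  \sum_(i < n.+1) level_energy f i = \sum_(k <- freqs n) cabs (fcoef f k) ^+ 2.
Proof.
elim: n => [|n ih]; first by rewrite big_ord_recr big_ord0 /= big_seq1 add0r.
by rewrite big_ord_recr ih /= !big_cat/= !big_map !sum_iota.
Qed.

Lemma block_sum_pos (phihat f : R -> C) n : L2c f ->
  block_sum phihat f (Posz n.+1) =
  (Enorm2 phihat n)^-1 * \sum_(j < 2 ^ n) cabs (cphi phihat n.+1 j) ^- 2 *
     cabs (fcoef f (Posz (2 ^ n + j))) ^+ 2.
Proof.
move=> lf; rewrite -sum_sqr_ip_Epos// mulr_sumr /block_sum absz_nat betaS.
apply: eq_bigr => tau _.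
rewrite /Fphi /Ephi norm2_Epos sqr_cabs_ip_div//; first exact: L2c_Epos.
by rewrite -(norm2_Epos phihat n 0); exact: norm2_ge0.
Qed.

Lemma block_sum_neg (phihat f : R -> C) n : L2c f ->
  block_sum phihat f (Negz n) =
  (Enorm2 phihat n)^-1 * \sum_(j < 2 ^ n) cabs (cphi phihat n.+1 j) ^- 2 *
     cabs (fcoef f (- Posz (2 ^ n + j))) ^+ 2.
Proof.
move=> lf; rewrite -sum_sqr_ip_conj_Epos// mulr_sumr /block_sum NegzE abszN
  absz_nat betaS.
apply: eq_bigr => tau _.
rewrite -NegzE /Fphi /Ephi norm2_conj norm2_Epos sqr_cabs_ip_div//.
  exact: L2c_conj_Epos.
by rewrite -(norm2_Epos phihat n 0); exact: norm2_ge0.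
Qed.

Lemma block_sum0 (phihat f : R -> C) : L2c f ->
  block_sum phihat f 0 = cabs (fcoef f 0) ^+ 2.
Proof.
move=> lf; rewrite /block_sum/= big_ord_recr big_ord0/= add0r.
have w0 : (fun=> 1) = wave 0 :> (R -> C).
  by apply/funext => t; rewrite /wave mul0r mulr0 expi0.
have L2c1 : L2c ((fun=> 1) : R -> C) by rewrite w0; exact: L2c_wave.
have n1 : norm2_01 ((fun=> 1) : R -> C) = 1.
  by apply: cR_inj; rewrite norm2_ip w0 ip01_wave eqxx.
rewrite /Fphi /Ephi n1 (sqr_cabs_ip_div (g := fun=> 1))// invr1 mul1r.
by rewrite /fcoef w0.
Qed.

Lemma level_sum_bounds (phihat f : R -> C) (delta M : R) n : L2c f ->
  0 < delta -> delta <= M ->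
  (forall n j, (j < 2 ^ n)%N -> delta <= cabs (cphi phihat n.+1 j) <= M) ->
  (delta / M) ^+ 2 * level_energy f n <= level_sum phihat f n
    <= (M / delta) ^+ 2 * level_energy f n.
Proof.
move=> lf d0 dM hc; have M0 : 0 < M by exact: lt_le_trans dM.
case: n => [|n]; rewrite /level_sum /level_energy.
  rewrite block_sum0// ler_piMl ?ler_peMl ?sqr_ge0//.
    by rewrite exprn_ege1// ler_pdivlMr// mul1r.
  by rewrite exprn_ile1 ?divr_ge0 ?(ltW d0) ?(ltW M0)// ler_pdivrMr// mul1r.
have b0 : (0 < 2 ^ n)%N by rewrite expn_gt0.
have W := @weighted_sum_bounds _ delta M (Enorm2 phihat n)
  (fun j : 'I_(2 ^ n) => cabs (cphi phihat n.+1 j)) _ b0 d0 (fun j => hc n j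
    (ltn_ord j)) _ erefl.
have /andP[p1 p2] := W (fun j => cabs (fcoef f (Posz (2 ^ n + j))) ^+ 2) (fun=>
  sqr_ge0 _).
have /andP[q1 q2] := W (fun j => cabs (fcoef f (- Posz (2 ^ n + j))) ^+ 2)
  (fun=> sqr_ge0 _).
rewrite block_sum_pos// block_sum_neg// !mulrDr.
apply/andP; split; [exact: lerD p1 q1|exact: lerD p2 q2].
Qed.

Lemma block_sum_ge0 (phihat f : R -> C) p : 0 <= block_sum phihat f p.
Proof. by apply: sumr_ge0 => i _; exact: sqr_ge0. Qed.

Lemma level_sum_ge0 (phihat f : R -> C) n : 0 <= level_sum phihat f n.
Proof. by case: n => [|n]; rewrite ?addr_ge0 ?block_sum_ge0. Qed.

Lemma frame_sumE (phihat f : R -> C) :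
  frame_sum phihat f = (\sum_(n <oo) (level_sum phihat f n)%:E)%E.
Proof.
pose a (p : int) (tau : nat) : \bar R :=
  (cabs (ip01 f (Fphi phihat p tau)) ^+ 2)%:E.
have a0 p tau : (0 <= a p tau)%E by rewrite lee_fin sqr_ge0.
transitivity (\esum_(p in [set: int]) (block_sum phihat f p)%:E)%E.
  rewrite /frame_sum.
  rewrite (_ : frame_index = [set: int] `*`` (fun p => `I_(beta `|p|%N)));
    last first.
    by apply/seteqP; split => [[p t]|[p t]] //= [].
  rewrite -(@esum_esum _ _ _ setT (fun p => `I_(beta `|p|%N)) a)//.
  apply: eq_esum => p _; rewrite esum_fset; [|exact: finite_II|by []].
  by rewrite /block_sum -sumEFin -fsbig_ord.
rewrite nneseries_esumT; last by move=> n; rewrite lee_fin level_sum_ge0.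
rewrite (_ : [set: int] = \bigcup_(n in [set: nat]) [set p : int | `|p|%N =
  n]); last first.
  by apply/seteqP; split => // p _; exists `|p|%N.
rewrite esum_bigcupT; last 2 first.
- by apply/trivIsetP => i j _ _ /eqP ij; apply/seteqP;
    split => // p /= [-> /ij].
- by move=> p; rewrite lee_fin block_sum_ge0.
apply: eq_esum => -[|n] _.
  rewrite (_ : [set p : int | _] = [set 0]).
    by rewrite esum_set1// lee_fin block_sum_ge0.
  by apply/seteqP; split => p /=; lia.
rewrite (esumID [set Posz n.+1]); last by move=> p _;
  rewrite lee_fin block_sum_ge0.
rewrite (_ : _ `&` [set Posz n.+1] = [set Posz n.+1]); last first.
  by apply/seteqP; split => p /=; [case|move=> ->].
rewrite (_ : _ `&` ~` [set Posz n.+1] = [set Negz n]); last first.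
  by apply/seteqP; split => p /=; [case; lia|move=> ->; split => //; lia].
by rewrite !esum_set1 ?lee_fin ?block_sum_ge0.
Qed.

End WindowFrame.

Theorem theorem6p5 (R : realType) (phihat : R -> complex.complex R) (delta M : R) :
  (* phihat in L^infty(R) *)
  (exists (g : R -> complex.complex R) (K : R),
      [/\ measurable_fun setT (fun x => complex.Re (g x)),
          measurable_fun setT (fun x => complex.Im (g x)),
          (forall x, cabs (g x) <= K) &
          {ae @lebesgue_measure R, forall x, phihat x = g x}]) ->
  (* phihat restricted to (-1/3,1/3) is continuous *)
  {within `](- (1/3)), (1/3)[, continuous (fun x => complex.Re (phihat x))} ->
  {within `](- (1/3)), (1/3)[, continuous (fun x => complex.Im (phihat x))} ->
  (* phihat does not vanish on (-1/3,1/3) *)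
  (forall x : R, - (1/3) < x < 1/3 -> phihat x != 0) ->
  (* phihat = 0 a.e. on |xi| > 1/3 *)
  {ae @lebesgue_measure R, forall x : R, 1/3 < `|x| -> phihat x = 0} ->
  (* the right limit at -1/3 exists (and is finite) *)
  cvg ((fun x => complex.Re (phihat x)) @ (- (1/3))^'+) ->
  cvg ((fun x => complex.Im (phihat x)) @ (- (1/3))^'+) ->
  (* inf |phihat| >= delta > 0 and sup |phihat| <= M on (-1/3,1/3) *)
  0 < delta ->
  (forall x : R, - (1/3) < x < 1/3 -> delta <= cabs (phihat x)) ->
  (forall x : R, - (1/3) < x < 1/3 -> cabs (phihat x) <= M) ->
  forall f : R -> complex.complex R, L2_01 f ->
    (((delta / M) ^+ 2 * norm2_01 f)%:E <= frame_sum phihat f)%E /\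
    (frame_sum phihat f <= ((M / delta) ^+ 2 * norm2_01 f)%:E)%E.
Proof.
move=> _ _ _ _ _ cr ci d0 hd hM f /L2_01_L2c lf.
have hext x := @phihat_ext_bounds R phihat delta M x cr ci d0 hd hM.
have dM : delta <= M.
  have z : - (1/3) < (0 : R) < 1/3 by apply/andP; split; lra.
  exact: le_trans (hd 0 z) (hM 0 z).
have hc n j := @cphi_bounds R phihat delta M n j hext.
have lb n := level_sum_bounds n lf d0 dM hc.
have l0 n : (0 <= (level_sum phihat f n)%:E)%E by rewrite lee_fin level_sum_ge0.
rewrite frame_sumE; split.
- apply/lee_addgt0Pr => e e0.
  have [d dpos hd'] := exists_mul_le (sqr_ge0 (delta / M)) e0.
  have [n /(_ n (leqnn n)) hn] := parseval_lower lf dpos.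
  apply: (@le_trans _ _ ((\sum_(i < n.+1) level_sum phihat f i) + e)%:E).
    rewrite lee_fin (le_trans (ler_wpM2l (sqr_ge0 _) hn))// mulrDr lerD//.
    rewrite -sum_level_energy mulr_sumr; apply: ler_sum => i _.
    by have /andP[] := lb i.
  rewrite EFinD leeD2r// -sumEFin.
  have := @nneseries_lim_ge R (fun n => (level_sum phihat f n)%:E) xpredT 0
    n.+1 (fun n _ _ => l0 n).
  by rewrite big_mkord.
- apply: lime_le; first by apply: is_cvg_nneseries => n _ _.
  apply: nearW => n; rewrite big_mkord sumEFin lee_fin.
  apply: (@le_trans _ _ (\sum_(i < n.+1) level_sum phihat f i)).
    by rewrite big_ord_recr/= lerDl level_sum_ge0.
  apply: le_trans (ler_wpM2l (sqr_ge0 _) (bessel n lf)).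
  rewrite -sum_level_energy mulr_sumr; apply: ler_sum => i _.
  by have /andP[] := lb i.
Qed.
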